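(* Let $G \in L^\infty$, $G \ne 0$. Then $1 \in \ker T_G$ if and only if $\ker T_G = K_{z\alpha}$ for some inner function $\alpha$.
   Context: $\mathbb T$ is the unit circle, $L^2=L^2(\mathbb T)$, $L^\infty=L^\infty(\mathbb T)$, $H^2_+=H^2(\mathbb D)$ is the Hardy space (identified with boundary functions on $\mathbb T$), and $P^+$ is the orthogonal projection of $L^2$ onto $H^2_+$. For $G\in L^\infty$, the Toeplitz operator is $T_G:H^2_+\to H^2_+$, $T_G f=P^+(Gf)$. For an inner function $\beta$, $K_\beta=H^2_+\ominus\beta H^2_+$ is the model space. Inner functions may be unimodular constants; $z$ denotes the function $z\mapsto z$. *)

(* Defs.v *)
From mathcomp Require Import all_boot all_order all_algebra.
From mathcomp Require Import complex.
From mathcomp Require Import all_classical all_reals all_analysis.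

Set Implicit Arguments.
Unset Strict Implicit.
Unset Printing Implicit Defensive.

Import Order.TTheory GRing.Theory Num.Theory.
Import numFieldNormedType.Exports.

Local Open Scope classical_set_scope.
Local Open Scope ring_scope.
Local Open Scope complex_scope.

(** A function on the unit circle is encoded by [f : R -> R[i]], where [f t]
    is its value at the point [e^(it)] for [t] in [[0, 2pi]].  Normalized
    arc length is the uniform probability on [[0, 2pi]], so the values of [f]
    outside that interval are irrelevant up to a.e. equality.  Elements of
    L^2 and L^oo are handled through measurable representatives: every subspace
    below is a set of functions that is stable under a.e. equality of measurable
    functions, so equality of two such sets is equality of the corresponding
    subspaces of L^2. *)

Section Circle.
Context {R : realType}.
Implicit Types (f g h G alpha beta : R -> R[i]) (M : set (R -> R[i])).

Lemma circle_length_gt0 : (0 : R) < 2 * pi.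
Proof. by rewrite mulr_gt0// pi_gt0. Qed.

Definition arc_length := uniform_prob circle_length_gt0.

Definition ae_equal f g : Prop := {ae arc_length, forall t, f t = g t}.

(** f is in L^p iff its real and imaginary parts are. *)
Definition Lp_circle (p : \bar R) : set (R -> R[i]) :=
  [set f | (fun t => complex.Re (f t)) \in Lfun arc_length p /\
           (fun t => complex.Im (f t)) \in Lfun arc_length p].

Definition L2 : set (R -> R[i]) := Lp_circle 2%:E.

Definition Linfty : set (R -> R[i]) := Lp_circle +oo%E.

Definition cintegral f : R[i] :=
  Rintegral arc_length setT (fun t => complex.Re (f t)) +i*
  Rintegral arc_length setT (fun t => complex.Im (f t)).

Definition inner_product f g : R[i] :=
  cintegral (fun t => f t * (g t)^*).

(** The function z on the circle. *)
Definition zeta : R -> R[i] := fun t => cos t +i* sin t.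

Definition fourier_coef f (n : int) : R[i] :=
  inner_product f (fun t => zeta t ^ n).

(** The Hardy space H^2, as a space of boundary functions: the functions in
    L^2 whose Fourier coefficients of negative index all vanish. *)
Definition hardy : set (R -> R[i]) :=
  [set f | L2 f /\ forall n : int, n < 0 -> fourier_coef f n = 0].

(** A representative of the orthogonal projection of f onto the closed
    subspace M of L^2, i.e. of the unique g in M with f - g orthogonal to M. *)
Definition orth_proj M f : R -> R[i] :=
  xget (cst 0) [set g | M g /\
    forall h, M h -> inner_product (fun t => f t - g t) h = 0].

Definition toeplitz G f : R -> R[i] :=
  orth_proj hardy (fun t => G t * f t).

Definition ker_toeplitz G : set (R -> R[i]) :=
  [set f | hardy f /\ ae_equal (toeplitz G f) (cst 0)].

Definition inner_function alpha : Prop :=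
  [/\ hardy alpha, Linfty alpha & {ae arc_length, forall t, `|alpha t| = 1}].

Definition model_space beta : set (R -> R[i]) :=
  [set f | hardy f /\
    forall h, hardy h -> inner_product f (fun t => beta t * h t) = 0].

End Circle.

(* Main.v *)
Require Import Defs.
From mathcomp Require Import all_boot all_order all_algebra.
From mathcomp Require Import complex.
From mathcomp Require Import all_classical all_reals all_analysis.
From mathcomp Require Import measurable_realfun ess_sup_inf zify ring lra.

(** Write z for zeta and H^2 for the Hardy space.  If T_G 1 = 0, then G is
    orthogonal to H^2.  A Hardy function f is in the kernel of T_G exactly when
    G f is orthogonal to every z^n with n >= 0, that is, when f is orthogonal to
    the closed span N of the functions conj(G) z^n ([ker_toeplitzP]).  The
    subspace N is invariant under multiplication by z, and it lies in z H^2
    because G is orthogonal to H^2.  Beurling's theorem ([beurling]) gives a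
    unimodular psi with N = psi H^2, and psi = z alpha with alpha inner; so the
    kernel is the orthogonal complement of z alpha H^2 in H^2, which is the model
    space of z alpha.  Conversely 1 is orthogonal to z alpha H^2, and thus is in
    that model space ([model_space_one]).  Using the invariant subspace generated
    by conj(G) in place of an inner-outer factorization of G avoids any theory of
    outer functions.

    Two facts about L^2 carry the argument.  The first is the existence of
    orthogonal projections onto closed subspaces ([orthogonal_decomposition]),
    which rests on the completeness of L^2: a rapidly Cauchy sequence converges
    almost everywhere ([rapidly_cauchy_ae_cvg]) and Fatou's lemma controls the
    limit.  The second is that an integrable function with vanishing Fourier
    coefficients is null ([fourier_null_ae_eq0]): indicators of arcs are bounded
    limits of trigonometric polynomials, obtained by composing the polynomials
    (1 - x^n)^(2^n) with a cosine.  Uniqueness in L^1, rather than in L^2 only, is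
    what shows that a wandering vector r of an invariant subspace has constant
    modulus, as |r|^2 is merely integrable. *)

Set Implicit Arguments.
Unset Strict Implicit.
Unset Printing Implicit Defensive.

Import Order.TTheory GRing.Theory Num.Theory.
Import numFieldNormedType.Exports.

(* With ring_scope on top, ^* denotes Num.conj, the conjugation that occurs in
   inner_product. *)
Local Open Scope classical_set_scope.
Local Open Scope complex_scope.
Local Open Scope ring_scope.

(** * Real and imaginary parts *)

Section ComplexArith.
Context {R : realType}.
Implicit Types x y : R[i].

Lemma ReD x y : complex.Re (x + y) = complex.Re x + complex.Re y.
Proof. by case: x y => [a b] [c d]. Qed.
Lemma ImD x y : complex.Im (x + y) = complex.Im x + complex.Im y.
Proof. by case: x y => [a b] [c d]. Qed.
Lemma ReN x : complex.Re (- x) = - complex.Re x.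
Proof. by case: x. Qed.
Lemma ImN x : complex.Im (- x) = - complex.Im x.
Proof. by case: x. Qed.
Lemma ReM x y :
  complex.Re (x * y) = complex.Re x * complex.Re y - complex.Im x * complex.Im y.
Proof. by case: x y => [a b] [c d]. Qed.
Lemma ImM x y :
  complex.Im (x * y) = complex.Re x * complex.Im y + complex.Im x * complex.Re y.
Proof. by case: x y => [a b] [c d]. Qed.
Lemma ReJ x : complex.Re x^* = complex.Re x.
Proof. by case: x. Qed.
Lemma ImJ x : complex.Im x^* = - complex.Im x.
Proof. by case: x. Qed.

Lemma complex_eqP x y :
  complex.Re x = complex.Re y -> complex.Im x = complex.Im y -> x = y.
Proof. by case: x y => [a b] [c d] /= -> ->. Qed.

(** The norm of R[i] takes its values in R[i]; its square, as an element of R,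
    is what can be integrated. *)
Definition sqmod x : R := complex.Re x ^+ 2 + complex.Im x ^+ 2.

Definition parts := (ReD, ImD, ReN, ImN, ReM, ImM, ReJ, ImJ).

Lemma sqmod_ge0 x : 0 <= sqmod x.
Proof. by rewrite addr_ge0 ?sqr_ge0. Qed.
Lemma sqmodM x y : sqmod (x * y) = sqmod x * sqmod y.
Proof. by rewrite /sqmod !parts; ring. Qed.
Lemma sqmodJ x : sqmod x^* = sqmod x.
Proof. by rewrite /sqmod !parts; ring. Qed.
Lemma mulrJ x : x * x^* = (sqmod x)%:C.
Proof. by apply: complex_eqP; rewrite !parts /= ?/sqmod; ring. Qed.
Lemma sqmod_eq0 x : sqmod x = 0 -> x = 0.
Proof.
move=> /eqP; rewrite /sqmod paddr_eq0 ?sqr_ge0// !sqrf_eq0 => /andP[/eqP a /eqP b].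
exact: complex_eqP.
Qed.
Lemma norm1_sqmod x : `|x| = 1 <-> sqmod x = 1.
Proof.
split=> h; first by have := add_Re2_Im2 x; rewrite h expr1n => -[].
by rewrite normc_def -/(sqmod x) h sqrtr1.
Qed.

End ComplexArith.

(** * Integrals of complex functions on the circle *)

Section CircleIntegral.
Context {R : realType}.
Local Notation mu := (@arc_length R).
Implicit Types (f g h G : R -> R[i]).

#[local] Instance ae_arc_length_filter : Filter (almost_everywhere mu).
Proof. exact: (ae_filter_ringOfSetsType mu). Qed.

Definition cmeasurable f :=
  measurable_fun [set: R] (fun t => complex.Re (f t)) /\
  measurable_fun [set: R] (fun t => complex.Im (f t)).

Definition cintegrable f :=
  mu.-integrable [set: R] (fun t => (complex.Re (f t))%:E) /\
  mu.-integrable [set: R] (fun t => (complex.Im (f t))%:E).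

Lemma cmeasurableD f g : cmeasurable f -> cmeasurable g ->
  cmeasurable (fun t => f t + g t).
Proof.
move=> [f1 f2] [g1 g2]; split; under eq_fun do rewrite !parts;
  exact: measurable_funD.
Qed.

Lemma cmeasurableM f g : cmeasurable f -> cmeasurable g ->
  cmeasurable (fun t => f t * g t).
Proof.
move=> [f1 f2] [g1 g2]; split; under eq_fun do rewrite !parts.
  by apply: measurable_funB; apply: measurable_funM.
by apply: measurable_funD; apply: measurable_funM.
Qed.

Lemma cmeasurableJ f : cmeasurable f -> cmeasurable (fun t => (f t)^*).
Proof.
move=> [f1 f2]; split; under eq_fun do rewrite !parts; first exact: f1.
exact: measurableT_comp.
Qed.

Lemma cmeasurable_cst (c : R[i]) : cmeasurable (fun=> c).
Proof. by split; exact: measurable_cst. Qed.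

Lemma cmeasurableN f : cmeasurable f -> cmeasurable (fun t => - f t).
Proof.
move=> [f1 f2]; split; under eq_fun do rewrite !parts;
  exact: measurableT_comp.
Qed.

Lemma cmeasurable_zeta : cmeasurable (@zeta R).
Proof.
split; rewrite /zeta /=.
  by apply: continuous_measurable_fun => t; exact: continuous_cos.
by apply: continuous_measurable_fun => t; exact: continuous_sin.
Qed.

Lemma sqmod_zeta t : sqmod (@zeta R t) = 1.
Proof. by rewrite /sqmod /zeta /= cos2Dsin2. Qed.

Lemma zeta_neq0 t : @zeta R t != 0.
Proof.
apply/eqP => h; have := sqmod_zeta t; rewrite h /sqmod /= expr0n /= addr0.
by move/eqP; rewrite eq_sym oner_eq0.
Qed.

Lemma zetaV t : (@zeta R t)^-1 = (zeta t)^*.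
Proof.
apply: (mulfI (zeta_neq0 t)); rewrite mulrJ sqmod_zeta divff//.
exact: zeta_neq0.
Qed.

Lemma zetaXJ t n : (@zeta R t ^ n)^* = zeta t ^ (- n).
Proof. by rewrite -exprz_inv zetaV; exact: (fmorphXz (@Num.conj R[i])). Qed.

Lemma zetaXD t m n : @zeta R t ^ (m + n) = zeta t ^ m * zeta t ^ n.
Proof. exact: expfzDr (zeta_neq0 t). Qed.

Lemma sqmod_zetaX t n : sqmod (@zeta R t ^ n) = 1.
Proof.
by apply: (@complexI R); rewrite -mulrJ zetaXJ -zetaXD subrr expr0z.
Qed.

Lemma cmeasurable_zetaX n : cmeasurable (fun t => @zeta R t ^ n).
Proof.
have pos k : cmeasurable (fun t => @zeta R t ^ Posz k).
  elim: k => [|k ih]; first by under eq_fun do rewrite expr0z; exact: cmeasurable_cst.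
  under eq_fun do rewrite exprSz.
  exact: cmeasurableM cmeasurable_zeta ih.
case: n => k; first exact: pos.
rewrite NegzE; under eq_fun do rewrite -zetaXJ.
exact: cmeasurableJ (pos _).
Qed.

Local Notation integrable u := (mu.-integrable [set: R] (fun t : R => (u t)%:E)).

Lemma rintegrableD (u v : R -> R) : integrable u -> integrable v ->
  integrable (fun t => u t + v t).
Proof. by move=> hu hv; exact: (integrableD measurableT hu hv). Qed.

Lemma rintegrableB (u v : R -> R) : integrable u -> integrable v ->
  integrable (fun t => u t - v t).
Proof. by move=> hu hv; exact: (integrableB measurableT hu hv). Qed.

Lemma rintegrableZ (r : R) (u : R -> R) : integrable u ->
  integrable (fun t => r * u t).
Proof. by move=> hu; exact: (integrableZl measurableT r hu). Qed.

Lemma ae_le_integrable (u v : R -> R) : measurable_fun [set: R] u ->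
  {ae mu, forall t, `|u t| <= v t} ->
  mu.-integrable [set: R] (fun t => (v t)%:E) ->
  mu.-integrable [set: R] (fun t => (u t)%:E).
Proof.
move=> mu_ uv /integrableP[mv iv]; apply/integrableP; split.
  exact/measurable_EFinP.
apply: le_lt_trans iv; apply: ae_ge0_le_integral => //.
- by do 2 apply: measurableT_comp => //.
- by apply: measurableT_comp.
- by apply: filterS uv => t h _ /=; rewrite lee_fin (le_trans h)// ler_norm.
Qed.

Lemma measurable_sqmod f : cmeasurable f ->
  measurable_fun [set: R] (fun t => sqmod (f t)).
Proof.
by move=> [f1 f2]; apply: measurable_funD; apply: measurable_funX.
Qed.

Lemma Lfun2P (u : R -> R) : u \in Lfun mu 2%:E <->
  measurable_fun [set: R] u /\ mu.-integrable [set: R] (fun t => (u t ^+ 2)%:E).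
Proof.
split=> [h|[mu_ iu]].
  split; last exact: Lfun2_integrable_sqr.
  by move: h; rewrite inE => /andP[]; rewrite inE.
rewrite inE; apply/andP; split; rewrite inE//= /finite_norm unlock.
apply: poweR_lty; move: iu => /integrableP[_]; apply: le_lt_trans.
rewrite le_eqVlt; apply/orP; left; apply/eqP; apply: eq_integral => t _ /=.
by rewrite powR_mulrn// normrX.
Qed.

Lemma L2P f : L2 f <->
  cmeasurable f /\ mu.-integrable [set: R] (fun t => (sqmod (f t))%:E).
Proof.
split=> [[/Lfun2P[f1 i1] /Lfun2P[f2 i2]]|[mf i]].
  split=> //.
  exact: rintegrableD.
have [f1 f2] := mf.
split; apply/Lfun2P; split=> //; apply: ae_le_integrable i; try
  (by apply: measurable_funX); apply: aeW => t /=.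
  by rewrite ger0_norm ?sqr_ge0// /sqmod lerDl sqr_ge0.
by rewrite ger0_norm ?sqr_ge0// /sqmod lerDr sqr_ge0.
Qed.

Lemma L2_cmeasurable f : L2 f -> cmeasurable f.
Proof. by move=> /L2P[]. Qed.

Lemma L2D f g : L2 f -> L2 g -> L2 (fun t => f t + g t).
Proof.
move=> /L2P[mf if_] /L2P[mg ig]; apply/L2P; split; first exact: cmeasurableD.
have i2 : mu.-integrable [set: R] (fun t => (2 * (sqmod (f t) + sqmod (g t)))%:E).
  by apply: rintegrableZ; exact: rintegrableD.
apply: ae_le_integrable i2; first by apply: measurable_sqmod; exact: cmeasurableD.
apply: aeW => t /=; rewrite ger0_norm ?sqmod_ge0// /sqmod !parts -subr_ge0.
set a := complex.Re (f t); set b := complex.Im (f t).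
set c := complex.Re (g t); set d := complex.Im (g t).
rewrite [X in 0 <= X](_ : _ = (a - c) ^+ 2 + (b - d) ^+ 2); last by ring.
by rewrite addr_ge0 ?sqr_ge0.
Qed.

Definition ae_bounded G := exists C : R, {ae mu, forall t, sqmod (G t) <= C}.

Lemma L2_mul_bounded G f : cmeasurable G -> ae_bounded G -> L2 f ->
  L2 (fun t => G t * f t).
Proof.
move=> mG [C GC] /L2P[mf if_]; apply/L2P; split; first exact: cmeasurableM.
have i2 : mu.-integrable [set: R] (fun t => (C * sqmod (f t))%:E).
  exact: rintegrableZ.
apply: ae_le_integrable i2; first by apply: measurable_sqmod; exact: cmeasurableM.
apply: filterS GC => t /= h; rewrite ger0_norm ?sqmod_ge0// sqmodM.
by rewrite ler_wpM2r ?sqmod_ge0.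
Qed.

Lemma ae_bounded_unimodular G : {ae mu, forall t, sqmod (G t) = 1} -> ae_bounded G.
Proof. by move=> h; exists 1; apply: filterS h => t ->. Qed.

Lemma ae_bounded_cst (c : R[i]) : ae_bounded (fun=> c).
Proof. by exists (sqmod c); apply: aeW => t. Qed.

Lemma ae_boundedJ G : ae_bounded G -> ae_bounded (fun t => (G t)^*).
Proof. by move=> [C h]; exists C; apply: filterS h => t; rewrite sqmodJ. Qed.

Lemma L2Z (c : R[i]) f : L2 f -> L2 (fun t => c * f t).
Proof.
by apply: L2_mul_bounded; [exact: cmeasurable_cst|exact: ae_bounded_cst].
Qed.

Lemma L2N f : L2 f -> L2 (fun t => - f t).
Proof. by move=> /(L2Z (-1)); under eq_fun do rewrite mulN1r. Qed.

Lemma L2B f g : L2 f -> L2 g -> L2 (fun t => f t - g t).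
Proof. by move=> hf /L2N; exact: L2D. Qed.

Lemma L2_zetaX_mul n f : L2 f -> L2 (fun t => @zeta R t ^ n * f t).
Proof.
apply: L2_mul_bounded; first exact: cmeasurable_zetaX.
by apply: ae_bounded_unimodular; apply: aeW => t; exact: sqmod_zetaX.
Qed.

Lemma L2_cst (c : R[i]) : L2 (fun _ : R => c).
Proof.
apply/L2P; split; first exact: cmeasurable_cst.
exact: finite_measure_integrable_cst.
Qed.

Lemma L2_bounded G : cmeasurable G -> ae_bounded G -> L2 G.
Proof.
move=> mG bG; have := L2_mul_bounded mG bG (L2_cst 1).
by under eq_fun do rewrite mulr1.
Qed.

Lemma L2_zetaX n : L2 (fun t => @zeta R t ^ n).
Proof.
by have := L2_zetaX_mul n (L2_cst 1); under eq_fun do rewrite mulr1.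
Qed.

Lemma cintegrable_mulJ f g : L2 f -> L2 g ->
  cintegrable (fun t => f t * (g t)^*).
Proof.
move=> [f1 f2] [g1 g2].
have I u v : u \in Lfun mu 2%:E -> v \in Lfun mu 2%:E ->
    mu.-integrable [set: R] (fun t => (u t * v t)%:E).
  by move=> hu hv; apply/(Lfun1_integrable mu)/Lfun2_mul_Lfun1.
split; under eq_fun do rewrite !parts ?mulrN ?opprK.
  by apply: rintegrableD; exact: I.
under eq_fun do rewrite addrC.
by apply: rintegrableB; exact: I.
Qed.

Lemma cintegrableD f g : cintegrable f -> cintegrable g ->
  cintegrable (fun t => f t + g t).
Proof.
move=> [f1 f2] [g1 g2].
by split; under eq_fun do rewrite !parts; exact: rintegrableD.
Qed.

Lemma cintegrableZ (c : R[i]) f : cintegrable f -> cintegrable (fun t => c * f t).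
Proof.
move=> [f1 f2]; split; under eq_fun do rewrite !parts.
  by apply: rintegrableB; exact: rintegrableZ.
by apply: rintegrableD; exact: rintegrableZ.
Qed.

Lemma cintegrable_cmeasurable f : cintegrable f -> cmeasurable f.
Proof.
by move=> [/integrableP[/measurable_EFinP f1 _] /integrableP[/measurable_EFinP f2 _]].
Qed.

Lemma cintegrable_mul_bounded G f : cmeasurable G -> ae_bounded G ->
  cintegrable f -> cintegrable (fun t => G t * f t).
Proof.
move=> mG [C GC] if_; have mf := cintegrable_cmeasurable if_.
have mGf := cmeasurableM mG mf.
have [f1 f2] := if_.
have i2 : mu.-integrable [set: R] (fun t => ((1 + C) *
    (`|complex.Re (f t)| + `|complex.Im (f t)|))%:E).
  by apply: rintegrableZ; apply: rintegrableD; exact: integrable_norm.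
(* |a| <= 1 + C whenever |a|^2 <= C, since |a| <= 1 + |a|^2 *)
have key a b c d : a ^+ 2 + b ^+ 2 <= C ->
    `|a * c| + `|b * d| <= (1 + C) * (`|c| + `|d|).
  move=> h; rewrite !normrM mulrDr lerD// ler_wpM2r//.
    have := sqr_ge0 (`|a| - 1); have := sqr_ge0 b.
    rewrite -(real_normK (num_real a)) in h; nra.
  have := sqr_ge0 (`|b| - 1); have := sqr_ge0 a.
  rewrite -(real_normK (num_real b)) in h; nra.
split; apply: ae_le_integrable i2; try exact: mGf.1; try exact: mGf.2.
  apply: filterS GC => t h; rewrite !parts.
  by apply: le_trans (ler_normB _ _) _; exact: key.
apply: filterS GC => t h; rewrite !parts.
apply: le_trans (ler_normD _ _) _; rewrite [X in _ <= _ * X]addrC.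
exact: key.
Qed.

Lemma cintegralD f g : cintegrable f -> cintegrable g ->
  cintegral (fun t => f t + g t) = cintegral f + cintegral g.
Proof.
move=> [f1 f2] [g1 g2]; apply: complex_eqP; rewrite !parts /=.
  by rewrite -RintegralD//; apply: eq_Rintegral => t _; rewrite !parts.
by rewrite -RintegralD//; apply: eq_Rintegral => t _; rewrite !parts.
Qed.

Lemma cintegralZ (c : R[i]) f : cintegrable f ->
  cintegral (fun t => c * f t) = c * cintegral f.
Proof.
move=> [f1 f2].
apply: complex_eqP; rewrite !parts /=.
  rewrite -!RintegralZl//; rewrite -RintegralB ?rintegrableZ//.
  by apply: eq_Rintegral => t _; rewrite !parts.
rewrite -!RintegralZl//; rewrite -RintegralD ?rintegrableZ//.
by apply: eq_Rintegral => t _; rewrite !parts.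
Qed.

Lemma cintegralJ f : cintegrable f ->
  cintegral (fun t => (f t)^*) = (cintegral f)^*.
Proof.
move=> [f1 f2]; apply: complex_eqP; rewrite !parts /=.
  by apply: eq_Rintegral => t _; rewrite !parts.
rewrite -mulN1r -RintegralZl//.
by apply: eq_Rintegral => t _; rewrite !parts mulN1r.
Qed.

Lemma ae_eq_cintegral f g : cmeasurable f -> cmeasurable g -> ae_equal f g ->
  cintegral f = cintegral g.
Proof.
move=> [f1 f2] [g1 g2] fg; apply: complex_eqP => /=; congr fine;
  apply: ae_eq_integral => //; try exact/measurable_EFinP;
  by apply: filterS fg => t /= ->.
Qed.

(** * The inner product of L^2 *)

Lemma ip_addl f g h : L2 f -> L2 g -> L2 h ->
  inner_product (fun t => f t + g t) h = inner_product f h + inner_product g h.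
Proof.
move=> hf hg hh; rewrite /inner_product -cintegralD; last 2 first.
- exact: cintegrable_mulJ.
- exact: cintegrable_mulJ.
by congr cintegral; apply/funext => t; rewrite mulrDl.
Qed.

Lemma ip_scalel (c : R[i]) f h : L2 f -> L2 h ->
  inner_product (fun t => c * f t) h = c * inner_product f h.
Proof.
move=> hf hh; rewrite /inner_product -cintegralZ; last exact: cintegrable_mulJ.
by congr cintegral; apply/funext => t; rewrite mulrA.
Qed.

Lemma ip_conj f g : L2 f -> L2 g -> inner_product g f = (inner_product f g)^*.
Proof.
move=> hf hg; rewrite /inner_product -cintegralJ; last exact: cintegrable_mulJ.
by congr cintegral; apply/funext => t; rewrite rmorphM/= conjCK mulrC.
Qed.

Lemma ip_subl f g h : L2 f -> L2 g -> L2 h ->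
  inner_product (fun t => f t - g t) h = inner_product f h - inner_product g h.
Proof.
move=> hf hg hh; rewrite ip_addl//; last exact: L2N.
congr (_ + _); under eq_fun do rewrite -mulN1r.
by rewrite ip_scalel// mulN1r.
Qed.

Lemma ip_scaler (c : R[i]) f h : L2 f -> L2 h ->
  inner_product f (fun t => c * h t) = c^* * inner_product f h.
Proof.
move=> hf hh; rewrite ip_conj//; last exact: L2Z.
by rewrite ip_scalel// rmorphM/= -ip_conj.
Qed.

Lemma ip_mull G f h :
  inner_product (fun t => G t * f t) h = inner_product f (fun t => (G t)^* * h t).
Proof.
congr cintegral; apply/funext => t; rewrite rmorphM/= conjCK; ring.
Qed.

Lemma ip_mulr G f h :
  inner_product f (fun t => G t * h t) = inner_product (fun t => (G t)^* * f t) h.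
Proof. by rewrite ip_mull; under [in RHS]eq_fun do rewrite conjCK. Qed.

Lemma ae_eq_ip f g h : L2 f -> L2 g -> L2 h -> ae_equal f g ->
  inner_product f h = inner_product g h.
Proof.
move=> /L2_cmeasurable mf /L2_cmeasurable mg /L2_cmeasurable /cmeasurableJ mh fg.
apply: ae_eq_cintegral; try exact: cmeasurableM.
by apply: filterS fg => t ->.
Qed.

Definition sqnorm f : R := \int[mu]_t sqmod (f t).

Lemma sqnorm_ge0 f : 0 <= sqnorm f.
Proof. by apply: Rintegral_ge0 => t _; exact: sqmod_ge0. Qed.

Lemma ip_self f : inner_product f f = (sqnorm f)%:C.
Proof.
rewrite /inner_product; under eq_fun do rewrite mulrJ.
apply: complex_eqP => //=.
by rewrite Rintegral_cst// mul0r.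
Qed.

Lemma sqnorm_eq0 f : L2 f -> sqnorm f = 0 -> ae_equal f (cst 0).
Proof.
move=> /L2P[mf if_] f0.
have [H _] := ae_eq_integral_abs mu measurableT (measurable_int mu if_).
have h : (\int[mu]_t `|(sqmod (f t))%:E| = 0)%E.
  under eq_integral do rewrite abse_EFin ger0_norm ?sqmod_ge0//.
  rewrite -[LHS]fineK; last exact: integrable_fin_num.
  by move: f0; rewrite /sqnorm /Rintegral => ->.
by apply: filterS (H h) => t /= /(_ I) [] /sqmod_eq0.
Qed.

Lemma sqnormD f g : L2 f -> L2 g ->
  sqnorm (fun t => f t + g t) =
  sqnorm f + sqnorm g + 2 * complex.Re (inner_product f g).
Proof.
move=> hf hg; have hfg := L2D hf hg.
have : (sqnorm (fun t => f t + g t))%:C =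
    (sqnorm f)%:C + (sqnorm g)%:C + (inner_product f g + (inner_product f g)^*).
  rewrite -!ip_self ip_addl// ip_conj// ip_addl// [X in _ + X = _]ip_conj//.
  rewrite ip_addl// !rmorphD/= -!ip_conj//; ring.
by move=> /(congr1 (@complex.Re R)); rewrite !ReD ReJ /= => ->; ring.
Qed.

Lemma sqnormZ (c : R[i]) f : L2 f -> sqnorm (fun t => c * f t) = sqmod c * sqnorm f.
Proof.
move=> /L2P[mf if_]; rewrite /sqnorm -RintegralZl//.
by apply: eq_Rintegral => t _; rewrite sqmodM.
Qed.

Lemma sqnorm_parallelogram f g : L2 f -> L2 g ->
  sqnorm (fun t => f t - g t) + sqnorm (fun t => f t + g t) =
  2 * sqnorm f + 2 * sqnorm g.
Proof.
move=> hf hg; have hNg := L2N hg.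
rewrite !sqnormD//.
have -> : sqnorm (fun t => - g t) = sqnorm g.
  by apply: eq_Rintegral => t _; rewrite /sqmod !parts !sqrrN.
have -> : inner_product f (fun t => - g t) = - inner_product f g.
  have := ip_scaler (-1) hf hg; rewrite rmorphN1 mulN1r => <-.
  by congr inner_product; apply/funext => t; rewrite mulN1r.
rewrite !parts; ring.
Qed.

(** The variational argument behind every orthogonality below: expanding
    |f + s h|^2 in a real parameter s produces such a quadratic. *)
Lemma quadratic_linear_coef0 (B C : R) :
  (forall s, 0 <= 2 * s * B + s ^+ 2 * C) -> B = 0.
Proof.
move=> h; apply/eqP/negP => /negP B0.
have C0 : 0 <= C.
  have := h 1; have := h (-1); lra.
have C1 : C + 1 != 0 by rewrite gt_eqF// ltr_wpDl.
(* near its minimiser - B / C; adding 1 avoids the case C = 0 *)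
have := h (- B / (C + 1)).
rewrite (_ : _ + _ = - (B ^+ 2 * (C + 2) / (C + 1) ^+ 2)); last by field.
rewrite oppr_ge0 leNgt divr_gt0 ?exprn_gt0 ?ltr_wpDl// mulr_gt0 ?ltr_wpDl//.
by rewrite exprn_even_gt0.
Qed.

(** * Completeness of L^2 *)

Lemma arc_length_setT : mu [set: R] = 1%E.
Proof. exact: (probability_setT (uniform_prob (@circle_length_gt0 R))). Qed.

Lemma arc_Rintegral_cst (r : R) : \int[mu]_(_ in [set: R]) r = r.
Proof.
rewrite Rintegral_cst// [X in fine X](_ : _ = 1%E) ?mulr1//.
exact: arc_length_setT.
Qed.

(** The arithmetic-geometric inequality turns the bound of order 4^-n on the
    squared increments into one of order 2^-n on their L^1 norms.  The sum of the increments
    is then integrable, so that it is finite almost everywhere, and the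
    sequence converges where it is. *)
Lemma rapidly_cauchy_ae_cvg (x : nat -> R -> R) :
  (forall n, measurable_fun [set: R] (x n)) ->
  (forall n, integrable (fun t => (x n.+1 t - x n t) ^+ 2)) ->
  (forall n, \int[mu]_t (x n.+1 t - x n t) ^+ 2 <= 4 * (2 ^+ n)^-1 ^+ 2) ->
  exists2 y : R -> R, measurable_fun [set: R] y &
    {ae mu, forall t, x n t @[n --> \oo] --> y t}.
Proof.
move=> mx ix bx.
pose d (n : nat) (t : R) : R := `|x n.+1 t - x n t|.
have md n : measurable_fun [set: R] (d n).
  by apply: measurableT_comp => //; exact: measurable_funB.
(* |a| <= (c + a^2 / c) / 2 with c = 2^-n *)
have dle n t : d n t <= 2^-1 * ((2 ^+ n)^-1 + 2 ^+ n * (x n.+1 t - x n t) ^+ 2).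
  rewrite /d; set a := _ - _; set c := 2 ^+ n.
  have c0 : 0 < c by exact: exprn_gt0.
  rewrite -(real_normK (num_real a)) -subr_ge0.
  rewrite (_ : _ - _ = 2^-1 * c^-1 * (c * `|a| - 1) ^+ 2); last first.
    by field; rewrite gt_eqF.
  by rewrite mulr_ge0 ?sqr_ge0// mulr_ge0// invr_ge0 ltW.
have icst (r : R) : integrable (fun=> r) by exact: finite_measure_integrable_cst.
have idom n : integrable (fun t =>
    2^-1 * ((2 ^+ n)^-1 + 2 ^+ n * (x n.+1 t - x n t) ^+ 2)).
  by apply: rintegrableZ; apply: rintegrableD => //; exact: rintegrableZ.
have intd n : (\int[mu]_t (d n t)%:E <= (6 / (2 ^ n.+1)%:R)%:E)%E.
  apply: (@le_trans _ _ (\int[mu]_t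
      (2^-1 * ((2 ^+ n)^-1 + 2 ^+ n * (x n.+1 t - x n t) ^+ 2))%:E)%E).
    apply: ge0_le_integral => //.
    - by move=> t _; rewrite lee_fin normr_ge0.
    - apply/measurable_EFinP; exact: md.
    - exact: measurable_int (idom n).
    - by move=> t _; rewrite lee_fin ?normr_ge0 ?dle.
  rewrite -[leLHS]fineK; last exact: integrable_fin_num.
  rewrite lee_fin -/(Rintegral mu setT _) RintegralZl//; last first.
    by apply: rintegrableD => //; exact: rintegrableZ.
  rewrite RintegralD//; [|exact: icst|exact: rintegrableZ].
  rewrite arc_Rintegral_cst RintegralZl//; last exact: ix.
  have c0 : 0 < 2 ^+ n :> R by exact: exprn_gt0.
  apply: (@le_trans _ _ (2^-1 * ((2 ^+ n)^-1 + 2 ^+ n * (4 * (2 ^+ n)^-1 ^+ 2)))).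
    by rewrite ler_pM2l// lerD2l ler_pM2l.
  rewrite natrX [2 ^+ n.+1]exprS -subr_ge0.
  rewrite (_ : _ - _ = 2^-1 * (2 ^+ n)^-1); last by field; rewrite gt_eqF.
  by rewrite mulr_ge0// invr_ge0 ltW.
have sumfin : (\int[mu]_t (\sum_(n <oo) (d n t)%:E) < +oo)%E.
  rewrite integral_nneseries//; last 2 first.
  - by move=> n; apply/measurable_EFinP; exact: md.
  - by move=> n t _; rewrite lee_fin ?normr_ge0 ?dle.
  apply: (@le_lt_trans _ _ (\sum_(n <oo) (6 / (2 ^ n.+1)%:R)%:E)%E).
    apply: lee_nneseries => [n _ _|n _]; last exact: intd.
    by apply: integral_ge0 => t _; rewrite lee_fin normr_ge0.
  by apply: le_lt_trans (epsilon_trick0 _ _) _ => //; rewrite ltry.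
have isum : mu.-integrable [set: R] (fun t => \sum_(n <oo) (d n t)%:E)%E.
  apply/integrableP; split.
    apply: ge0_emeasurable_sum => [n t _ _|n _].
      by rewrite lee_fin normr_ge0.
    by apply/measurable_EFinP; exact: md.
  apply: le_lt_trans sumfin; rewrite le_eqVlt; apply/orP; left; apply/eqP.
  apply: eq_integral => t _; rewrite gee0_abs//.
  by apply: nneseries_ge0 => n _ _; rewrite lee_fin normr_ge0.
have [N [mN N0 Nsub]] := integrable_ae measurableT isum.
have cx t : ~ N t -> cvgn (x ^~ t).
  move=> Nt; have fint : (\sum_(n <oo) (d n t)%:E)%E \is a fin_num.
    by apply: contrapT => h; apply: Nt; apply: Nsub => /= /(_ I).
  have : cvgn [normed series (fun n => x n.+1 t - x n t)].
    apply: (nnseries_is_cvg (u := d ^~ t)) => [n|]; first exact: normr_ge0.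
    rewrite -ge0_fin_numE//; apply: nneseries_ge0 => n _ _.
    by rewrite lee_fin normr_ge0.
  move=> /normed_cvg; rewrite -[fun n => _]/(telescope (x ^~ t)) telescopeK => h.
  rewrite (_ : x ^~ t = (fun n => x n t - x 0%N t + x 0%N t)); last first.
    by apply/funext => n; rewrite subrK.
  by apply: is_cvgD; [exact: h|exact: is_cvg_cst].
(* cutting off on the null set N makes the convergence hold everywhere, which
   is what gives the measurability of the limit *)
pose y t := lim (x n t * \1_(~` N) t @[n --> \oo]).
have cy t : x n t * \1_(~` N) t @[n --> \oo] --> y t.
  have [Nt|Nt] := pselect (N t).
    rewrite /y indicE memNset/=; last by apply.
    by under eq_fun do rewrite mulr0; exact: is_cvg_cst.
  by apply: is_cvgMl; exact: cx.
exists y.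
  apply: (measurable_fun_cvg (h := fun n t => x n t * \1_(~` N) t)).
    move=> n; apply: measurable_funM => //.
    by apply: measurable_indic; exact: measurableC.
  by move=> t _; exact: cy.
exists N; split=> // t; apply: contra_notP => Nt.
by have := cy t; rewrite indicE mem_set//=; under eq_fun do rewrite mulr1.
Qed.

Definition ccvg (u : nat -> R[i]) (l : R[i]) : Prop :=
  complex.Re (u n) @[n --> \oo] --> complex.Re l /\
  complex.Im (u n) @[n --> \oo] --> complex.Im l.

Lemma ccvg_subr u l (c : R[i]) : ccvg u l -> ccvg (fun n => u n - c) (l - c).
Proof.
move=> [u1 u2]; split; under eq_fun do rewrite !parts; rewrite !parts;
  by apply: cvgB => //; exact: cvg_cst.
Qed.

Lemma ccvg_subl u l (c : R[i]) : ccvg u l -> ccvg (fun n => c - u n) (c - l).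
Proof.
move=> [u1 u2]; split; under eq_fun do rewrite !parts; rewrite !parts;
  by apply: cvgB => //; exact: cvg_cst.
Qed.

Lemma ccvg_shift u l N : ccvg u l -> ccvg (fun n => u (n + N)%N) l.
Proof.
by move=> [u1 u2]; split; [rewrite (cvg_shiftn N (fun n => complex.Re (u n)))|
  rewrite (cvg_shiftn N (fun n => complex.Im (u n)))].
Qed.

Lemma sqmod_cvg u l : ccvg u l -> sqmod (u n) @[n --> \oo] --> sqmod l.
Proof.
by move=> [u1 u2]; apply: cvgD; rewrite !expr2; under eq_fun do rewrite expr2;
  exact: cvgM.
Qed.

(** Fatou's lemma for the squared norm: it yields at once that an almost
    everywhere limit is in L^2 and that the norm does not jump up. *)
Lemma sqnorm_fatou (u : nat -> R -> R[i]) g (K : R) :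
  (forall n, L2 (u n)) -> cmeasurable g ->
  {ae mu, forall t, ccvg (u ^~ t) (g t)} ->
  (forall n, sqnorm (u n) <= K) -> L2 g /\ sqnorm g <= K.
Proof.
move=> hu mg [N [mN N0 Nsub]] uK.
have mgg := measurable_sqmod mg.
have muu n : measurable_fun [set: R] (fun t => (sqmod (u n t))%:E).
  by apply/measurable_EFinP; apply: measurable_sqmod; apply: L2_cmeasurable.
have iu n : (\int[mu]_t (sqmod (u n t))%:E = (sqnorm (u n))%:E)%E.
  rewrite -[LHS]fineK//; apply: integrable_fin_num => //.
  by have /L2P[] := hu n.
have mNC : measurable (~` N) by exact: measurableC.
have sg0 t : (0 <= (sqmod (g t))%:E)%E by rewrite lee_fin sqmod_ge0.
have su0 n t : (0 <= (sqmod (u n t))%:E)%E by rewrite lee_fin sqmod_ge0.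
have le : (\int[mu]_t (sqmod (g t))%:E <= K%:E)%E.
  rewrite (ge0_negligible_integral mN)//; last exact/measurable_EFinP.
  rewrite setTD.
  have -> : (\int[mu]_(t in ~` N) (sqmod (g t))%:E =
      \int[mu]_(t in ~` N) limn_einf (fun n => (sqmod (u n t))%:E))%E.
    apply: eq_integral => t; rewrite inE => Nt.
    have : ccvg (u ^~ t) (g t) by apply: contrapT => h; apply: Nt; exact: Nsub.
    move=> /sqmod_cvg h.
    have he : (sqmod (u n t))%:E @[n --> \oo] --> (sqmod (g t))%:E.
      by apply: cvg_EFin h; exact: nearW.
    by have [-> _] := cvg_limn_einf_sup he.
  apply: le_trans (fatou mu mNC _ _) _ => //.
    by move=> n; exact: measurable_funTS (muu n).
  rewrite limn_einf_lim; apply: lime_le; first exact: is_cvg_einfs.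
  apply: nearW => n; apply: le_trans (ereal_inf_lbound _) _; first by exists n => /=.
  apply: (@le_trans _ _ (\int[mu]_t (sqmod (u n t))%:E)%E).
    exact: (ge0_subset_integral mu mNC measurableT (muu n) (fun t _ => su0 n t)).
  by rewrite iu lee_fin.
have ig : mu.-integrable [set: R] (fun t => (sqmod (g t))%:E).
  apply/integrableP; split; first exact/measurable_EFinP.
  under eq_integral do rewrite gee0_abs//.
  by apply: le_lt_trans le _; rewrite ltry.
split; first by apply/L2P.
by rewrite -lee_fin /sqnorm /Rintegral fineK//; exact: integrable_fin_num.
Qed.

Lemma L2_rapidly_cauchy_ae_cvg (u : nat -> R -> R[i]) :
  (forall n, L2 (u n)) ->
  (forall n, sqnorm (fun t => u n.+1 t - u n t) <= 4 * (2 ^+ n)^-1 ^+ 2) ->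
  exists2 g, cmeasurable g & {ae mu, forall t, ccvg (u ^~ t) (g t)}.
Proof.
move=> hu bu.
have mu_ n := L2_cmeasurable (hu n).
have isq n : integrable (fun t => sqmod (u n.+1 t - u n t)).
  by have /L2P[] := L2B (hu n.+1) (hu n).
have mB n (p : R[i] -> R) : measurable_fun [set: R] (fun t => p (u n.+1 t)) ->
    measurable_fun [set: R] (fun t => p (u n t)) ->
    measurable_fun [set: R] (fun t => (p (u n.+1 t) - p (u n t)) ^+ 2).
  by move=> h1 h2; apply: measurable_funX; exact: measurable_funB.
have [||n|a ma ca] := @rapidly_cauchy_ae_cvg (fun n t => complex.Re (u n t)).
- by move=> n; have [] := mu_ n.
- move=> n; apply: ae_le_integrable (isq n).
    by apply: mB; [have [] := mu_ n.+1|have [] := mu_ n].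
  by apply: aeW => t; rewrite ger0_norm ?sqr_ge0// /sqmod !parts lerDl sqr_ge0.
- apply: le_trans (bu n); apply: le_Rintegral => //.
  + apply: ae_le_integrable (isq n).
      by apply: mB; [have [] := mu_ n.+1|have [] := mu_ n].
    by apply: aeW => t; rewrite ger0_norm ?sqr_ge0// /sqmod !parts lerDl sqr_ge0.
  + exact: isq.
  + by move=> t _; rewrite /sqmod !parts lerDl sqr_ge0.
have [||n|b mb cb] := @rapidly_cauchy_ae_cvg (fun n t => complex.Im (u n t)).
- by move=> n; have [] := mu_ n.
- move=> n; apply: ae_le_integrable (isq n).
    by apply: mB; [have [] := mu_ n.+1|have [] := mu_ n].
  by apply: aeW => t; rewrite ger0_norm ?sqr_ge0// /sqmod !parts lerDr sqr_ge0.
- apply: le_trans (bu n); apply: le_Rintegral => //.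
  + apply: ae_le_integrable (isq n).
      by apply: mB; [have [] := mu_ n.+1|have [] := mu_ n].
    by apply: aeW => t; rewrite ger0_norm ?sqr_ge0// /sqmod !parts lerDr sqr_ge0.
  + exact: isq.
  + by move=> t _; rewrite /sqmod !parts lerDr sqr_ge0.
exists (fun t => a t +i* b t) => //.
by apply: filterS2 ca cb => t; split.
Qed.

(** * Closed subspaces and orthogonal projections *)

(** Closed subspaces enter only in this form: every closed subspace of L^2 is
    an annihilator, and [ann (ann A)] is the closed linear span of [A]. *)
Definition ann (A : set (R -> R[i])) : set (R -> R[i]) :=
  [set f | L2 f /\ forall h, A h -> inner_product f h = 0].

Implicit Types A : set (R -> R[i]).

Lemma annD A f g : A `<=` L2 -> ann A f -> ann A g -> ann A (fun t => f t + g t).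
Proof.
move=> AL [hf of_] [hg og]; split; first exact: L2D.
by move=> h Ah; rewrite ip_addl ?of_ ?og ?addr0//; exact: AL.
Qed.

Lemma annZ A (c : R[i]) f : A `<=` L2 -> ann A f -> ann A (fun t => c * f t).
Proof.
move=> AL [hf of_]; split; first exact: L2Z.
by move=> h Ah; rewrite ip_scalel ?of_ ?mulr0//; exact: AL.
Qed.

Lemma annB A f g : A `<=` L2 -> ann A f -> ann A g -> ann A (fun t => f t - g t).
Proof.
move=> AL hf /(annZ (-1) AL) hg; under eq_fun do rewrite -mulN1r.
exact: annD.
Qed.

Lemma ae_eq_ann A f g : A `<=` L2 -> L2 g -> ae_equal f g -> ann A f -> ann A g.
Proof.
move=> AL hg fg [hf of_]; split=> // h Ah.
rewrite -(@ae_eq_ip f)//; [exact: of_|exact: AL].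
Qed.

Lemma sub_ann_ann A : A `<=` L2 -> A `<=` ann (ann A).
Proof.
move=> AL f Af; split; first exact: AL.
by move=> h [hh oh]; rewrite ip_conj// ?oh ?conjC0//; exact: AL.
Qed.

Lemma ann_anti A B : A `<=` B -> ann B `<=` ann A.
Proof. by move=> AB f [hf of_]; split=> // h /AB /of_. Qed.

Lemma ann_ann_ann A : A `<=` L2 -> ann (ann (ann A)) = ann A.
Proof.
move=> AL; apply/seteqP; split.
  exact/ann_anti/sub_ann_ann.
by apply: sub_ann_ann => f [].
Qed.

(** Taking c = <f, h> makes the real part equal to |<f, h>|^2, so that
    real-parameter arguments suffice for complex orthogonality. *)
Lemma ip_eq0_of_Re f h : L2 f -> L2 h ->
  (forall c, complex.Re (inner_product f (fun t => c * h t)) = 0) ->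
  inner_product f h = 0.
Proof.
move=> hf hh /(_ (inner_product f h)); rewrite ip_scaler// mulrC mulrJ /=.
exact: sqmod_eq0.
Qed.

Lemma sqnormDZ f h (s : R) : L2 f -> L2 h ->
  sqnorm (fun t => f t + (s%:C) * h t) =
  sqnorm f + 2 * s * complex.Re (inner_product f h) + s ^+ 2 * sqnorm h.
Proof.
move=> hf hh; rewrite sqnormD//; last exact: L2Z.
rewrite ip_scaler// sqnormZ// -[(s%:C)^*]/(conjc s%:C) conjc_real /sqmod !parts /=.
ring.
Qed.

(** For k in [ann A] close to g, <g, h> = <g - k, h>.  Hence the quadratic
    |g - k|^2 + 2 s Re <g, h> + s^2 |h|^2 is nonnegative with an arbitrarily
    small constant term. *)
Lemma ann_closed A g : A `<=` L2 -> L2 g ->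
  (forall e, 0 < e -> exists2 k, ann A k & sqnorm (fun t => g t - k t) <= e) ->
  ann A g.
Proof.
move=> AL hg H; split=> // h /[dup] Ah /AL hh; apply: ip_eq0_of_Re => // c.
have hch := L2Z c hh.
apply: (@quadratic_linear_coef0 _ (sqnorm (fun t => c * h t))) => s.
apply/ler_addgt0Pr => e /H[k [hk ok] le].
have hgk := L2B hg hk.
have eqip : inner_product (fun t => g t - k t) (fun t => c * h t) =
    inner_product g (fun t => c * h t).
  by rewrite ip_subl// [X in _ - X]ip_scaler// ok// mulr0 subr0.
have := sqnorm_ge0 (fun t => (g t - k t) + s%:C * (c * h t)).
rewrite sqnormDZ// eqip; lra.
Qed.

(** The nearest point g to f in a closed subspace.  By the parallelogram law a
    minimising sequence is Cauchy; its almost everywhere limit is in the subspace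
    and is a minimiser by Fatou's lemma; and minimality makes f - g orthogonal to
    the subspace. *)
Lemma orthogonal_decomposition A f : A `<=` L2 -> L2 f ->
  exists2 g, ann A g & ann (ann A) (fun t => f t - g t).
Proof.
move=> AL hf.
pose E := [set sqnorm (fun t => f t - k t) | k in ann A].
have annAL : ann A `<=` L2 by move=> k [].
have A0 : ann A (fun=> 0).
  split; first exact: L2_cst.
  move=> h /AL hh; have := ip_scalel 0 (L2_cst 0) hh.
  by under eq_fun do rewrite mul0r; rewrite mul0r.
have infE : has_inf E.
  split; first by exists (sqnorm (fun t => f t - 0)); exists (fun=> 0).
  by exists 0 => _ [k _ <-]; exact: sqnorm_ge0.
pose d := inf E.
have dle k : ann A k -> d <= sqnorm (fun t => f t - k t).
  by move=> hk; apply: ge_inf; [exact: infE.2|exists k].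
pose e n : R := (2 ^+ n)^-1 ^+ 2.
have e0 n : 0 < e n by rewrite exprn_gt0// invr_gt0 exprn_gt0.
have /choice[k hk] : forall n, exists k,
    ann A k /\ sqnorm (fun t => f t - k t) <= d + e n.
  move=> n; have [_ [k Ak <-] /ltW le] := inf_adherent (e0 n) infE.
  by exists k.
have Ak n : ann A (k n) by have [] := hk n.
have lek n : sqnorm (fun t => f t - k n t) <= d + e n by have [] := hk n.
have Lk n := annAL _ (Ak n).
have eS m n : (n <= m)%N -> e m <= e n.
  move=> nm; rewrite /e ler_pXn2r ?nnegrE ?invr_ge0 ?exprn_ge0//.
  by rewrite lef_pV2 ?posrE ?exprn_gt0// ler_weXn2l// ler1n.
(* the midpoint of k m and k n is again a competitor *)
have cauchy m n : (n <= m)%N -> sqnorm (fun t => k m t - k n t) <= 4 * e n.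
  move=> nm; have hm := L2B hf (Lk m); have hn := L2B hf (Lk n).
  have := sqnorm_parallelogram hn hm.
  have -> : (fun t => f t - k n t - (f t - k m t)) = (fun t => k m t - k n t).
    by apply/funext => t; ring.
  have -> : (fun t => f t - k n t + (f t - k m t)) =
      (fun t => 2%:R * (f t - 2^-1 * (k n t + k m t))).
    by apply/funext => t; field.
  have hmid : ann A (fun t => 2^-1 * (k n t + k m t)).
    by apply: annZ => //; exact: annD.
  rewrite sqnormZ; last by apply: L2B => //; exact: annAL.
  have -> : sqmod (2%:R : R[i]) = 4.
    by rewrite /sqmod [2%:R]mulr2n !parts /=; ring.
  have := dle _ hmid; have := lek n; have := lek m; have := eS _ _ nm; lra.
have [g mg kg] := @L2_rapidly_cauchy_ae_cvg k Lk (fun n => cauchy _ _ (leqnSn n)).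
have fatou_k n : L2 (fun t => g t - k n t) /\
    sqnorm (fun t => g t - k n t) <= 4 * e n.
  apply: (@sqnorm_fatou (fun m t => k (m + n)%N t - k n t)).
  - by move=> m; exact: L2B.
  - apply: cmeasurableD => //; apply: cmeasurableN; exact: L2_cmeasurable.
  - apply: filterS kg => t kt; apply: ccvg_subr.
    exact: (ccvg_shift (u := k ^~ t)).
  - by move=> m; apply: cauchy; rewrite leq_addl.
have Lg : L2 g.
  have := L2D (fatou_k 0%N).1 (Lk 0%N).
  by under eq_fun do rewrite subrK.
have ecvg r : 0 < r -> exists n, 4 * e n <= r.
  move=> r0; have : (fun n => 4 * (4^-1 ^+ n)) @ \oo --> (4 * 0 : R).
    apply: cvgM; first exact: cvg_cst.
    by apply: cvg_expr; rewrite ger0_norm// invf_lt1// ltr1n.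
  rewrite mulr0 => /cvgrPdist_le/(_ _ r0) [n _ /(_ n (leqnn n))] /=.
  rewrite sub0r normrN => h; exists n.
  apply: le_trans h; rewrite ger0_norm ?mulr_ge0// ?exprn_ge0//.
  by rewrite ler_pM2l// /e -!exprVn exprAC expr2 -invfM -natrM.
have Ag : ann A g.
  apply: ann_closed => // r /ecvg[n ler]; exists (k n) => //.
  exact: le_trans (fatou_k n).2 ler.
exists g => //.
have Lfg := L2B hf Lg.
have dfg : sqnorm (fun t => f t - g t) <= d.
  apply/ler_addgt0Pr => r /ecvg[n ler].
  suff [] : L2 (fun t => f t - g t) /\
      sqnorm (fun t => f t - g t) <= d + r by [].
  apply: (@sqnorm_fatou (fun m t => f t - k (m + n)%N t)).
  - by move=> m; exact: L2B.
  - exact: L2_cmeasurable.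
  - apply: filterS kg => t kt; apply: ccvg_subl.
    exact: (ccvg_shift (u := k ^~ t)).
  - move=> m; apply: le_trans (lek _) _; rewrite lerD2l; apply: le_trans ler.
    apply: le_trans (eS _ _ (leq_addl m n)) _.
    by rewrite ler_peMl ?ler1n// ltW.
split=> // h hh; have Lh := annAL _ hh.
apply: ip_eq0_of_Re => // c.
have hch := annZ c AL hh; have Lch := annAL _ hch.
apply: (@quadratic_linear_coef0 _ (sqnorm (fun t => c * h t))) => s.
have := dle _ (annB AL Ag (annZ (s%:C) AL hch)).
have -> : (fun t => f t - (g t - s%:C * (c * h t))) =
    (fun t => (f t - g t) + s%:C * (c * h t)) by apply/funext => t; ring.
rewrite sqnormDZ//; lra.
Qed.

(** * Uniqueness of Fourier coefficients in L^1 *)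

(** On [0, 1] these polynomials tend boundedly to the indicator of [0, 1/2),
    except at 1/2: by Bernoulli's inequality they are at least 1 - (2x)^n and at
    most (2x)^-n. *)
Definition step_poly (n : nat) (x : R) : R := (1 - x ^+ n) ^+ (2 ^ n).

Lemma step_poly_itv n x : 0 <= x <= 1 -> 0 <= step_poly n x <= 1.
Proof.
move=> /andP[x0 x1]; have y0 : 0 <= x ^+ n by exact: exprn_ge0.
have y1 : x ^+ n <= 1 by exact: exprn_ile1.
by rewrite exprn_ge0 ?subr_ge0//= exprn_ile1 ?subr_ge0// lerBlDr lerDl.
Qed.

Lemma bernoulli_ge (y : R) m : 0 <= y <= 1 -> 1 - m%:R * y <= (1 - y) ^+ m.
Proof.
move=> /andP[y0 y1]; elim: m => [|m ih]; first by rewrite mul0r subr0 expr0.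
rewrite exprS; apply: le_trans (_ : (1 - y) * (1 - m%:R * y) <= _); last first.
  by rewrite ler_wpM2l// subr_ge0.
rewrite -natr1; have := mulr_ge0 (ler0n R m) (sqr_ge0 y); lra.
Qed.

Lemma bernoulli_le (y : R) m : 0 <= y <= 1 -> (1 - y) ^+ m * (m%:R * y) <= 1.
Proof.
move=> /andP[y0 y1].
have h : 1 + m%:R * y <= (1 + y) ^+ m.
  elim: m => [|m ih]; first by rewrite mul0r addr0 expr0.
  rewrite exprS; apply: le_trans (_ : _ <= (1 + y) * (1 + m%:R * y)) _; last first.
    by rewrite ler_wpM2l// addr_ge0.
  rewrite -natr1; have := mulr_ge0 (ler0n R m) (sqr_ge0 y); lra.
apply: (@le_trans _ _ ((1 - y) ^+ m * (1 + y) ^+ m)).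
  by rewrite ler_wpM2l ?exprn_ge0 ?subr_ge0//; lra.
rewrite -exprMn exprn_ile1//; nra.
Qed.

Lemma step_poly_cvg1 x : 0 <= x < 2^-1 -> step_poly n x @[n --> \oo] --> (1 : R).
Proof.
move=> /andP[x0 xh].
apply: (@squeeze_cvgr _ _ _ _ (fun n => 1 - (2 * x) ^+ n) (fun=> 1)).
- apply: nearW => n; apply/andP; split; last first.
    have /andP[//] : 0 <= step_poly n x <= 1.
    by apply: step_poly_itv; rewrite x0 /=; lra.
  rewrite exprMn -natrX; apply: bernoulli_ge.
  by rewrite exprn_ge0//= exprn_ile1//; lra.
- rewrite -[X in _ --> X]subr0; apply: cvgB; first exact: cvg_cst.
  by apply: cvg_expr; rewrite ger0_norm; lra.
- exact: cvg_cst.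
Qed.

Lemma step_poly_cvg0 x : 2^-1 < x <= 1 -> step_poly n x @[n --> \oo] --> (0 : R).
Proof.
move=> /andP[xh x1]; have x0 : 0 < x by lra.
apply: (@squeeze_cvgr _ _ _ _ (fun=> 0) (fun n => (2 * x)^-1 ^+ n)).
- apply: nearW => n; have /andP[-> _] /= : 0 <= step_poly n x <= 1.
    by apply: step_poly_itv; rewrite ltW.
  rewrite exprVn -[leRHS]mul1r ler_pdivlMr ?exprn_gt0 ?mulr_gt0//.
  rewrite exprMn -natrX; apply: bernoulli_le.
  by apply/andP; split; [apply: exprn_ge0|apply: exprn_ile1] => //; exact: ltW.
- exact: cvg_cst.
- by apply: cvg_expr; rewrite ger0_norm ?invr_ge0 ?invf_lt1; lra.
Qed.

(** A trigonometric polynomial with values in [0, 1] that exceeds 1/2 exactly on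
    the arc from 0 to a: there cos (t - a/2) > cos (a/2), because t is closer to
    the midpoint a/2 of the arc than its endpoints are. *)
Definition arc_poly (a t : R) : R := 2^-1 + (cos (t - a / 2) - cos (a / 2)) / 4.

Lemma arc_poly_itv a t : 0 <= arc_poly a t <= 1.
Proof.
have := cos_geN1 (t - a / 2); have := cos_le1 (t - a / 2).
have := cos_geN1 (a / 2); have := cos_le1 (a / 2).
rewrite /arc_poly => ? ? ? ?; apply/andP; split; lra.
Qed.

Lemma arc_poly_gt a t : 0 <= a <= 2 * pi -> 0 < t < a -> 2^-1 < arc_poly a t.
Proof.
move=> /andP[a0 a1] /andP[t0 ta]; rewrite /arc_poly.
suff : cos (a / 2) < cos (t - a / 2) by lra.
rewrite -(cos_norm (t - a / 2)) ltr_cos ?in_itv/=.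
- by rewrite ltr_norml; apply/andP; split; lra.
- by rewrite normr_ge0 ler_norml; apply/andP; split; lra.
- by apply/andP; split; lra.
Qed.

Lemma arc_poly_lt a t : 0 <= a <= 2 * pi -> a < t < 2 * pi -> arc_poly a t < 2^-1.
Proof.
move=> /andP[a0 a1] /andP[at_ t1]; rewrite /arc_poly.
suff : cos (t - a / 2) < cos (a / 2) by lra.
have [h|h] := leP (t - a / 2) pi.
  by rewrite ltr_cos ?in_itv/=; try (apply/andP; split); lra.
(* past the antipode of a / 2, measure the distance the other way round *)
rewrite -(cosN (t - a / 2)) -cosD2pi [pi *+ 2]mulr2n.
by rewrite ltr_cos ?in_itv/=; try (apply/andP; split); lra.
Qed.

Lemma arc_length_set1 a : mu [set a] = 0%E.
Proof.
apply: (@dominates_uniform_prob R _ _ (@circle_length_gt0 R) [set a]) => //.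
apply/measure0_null_setP => //; exact: lebesgue_measure_set1.
Qed.

Lemma ae_neq a : {ae mu, forall t, t != a}.
Proof.
exists [set a]; split => //; first exact: arc_length_set1.
by move=> t /= /negP; rewrite negbK => /eqP.
Qed.

Lemma ae_itv : {ae mu, forall t, 0 < t < 2 * pi}.
Proof.
have h : {ae mu, forall t, 0 <= t <= 2 * pi}.
  exists (~` `[0, 2 * pi]%classic); split => //.
  - exact: measurableC.
  - rewrite /arc_length /uniform_prob integral_uniform_pdf setICl.
    exact: integral_set0.
apply: filterS3 h (ae_neq 0) (ae_neq (2 * pi)) => t /andP[t0 t1] n0 n1.
by rewrite !lt_neqAle eq_sym n0 t0 n1.
Qed.

(** The measurable sets over which v integrates to 0 form a Dynkin system, and
    the rays are a generating pi-system. *)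
Lemma ae_eq0_of_rays (v : R -> R) : integrable v ->
  (\int[mu]_t (v t)%:E = 0)%E ->
  (forall a, \int[mu]_(t in `]a, +oo[) (v t)%:E = 0)%E ->
  {ae mu, forall t, v t = 0}.
Proof.
move=> iv v0 ray0.
have iE (E : set R) : measurable E -> mu.-integrable E (fun t => (v t)%:E).
  by move=> mE; apply: integrableS iv.
have all0 (E : set R) : measurable E -> (\int[mu]_(t in E) (v t)%:E = 0)%E.
  move=> mE; have mE' : <<s (@RGenOInfty.G R) >> E.
    by rewrite -[<<s _ >>](RGenOInfty.measurableE R).
  apply: (@dynkin_induction _ _ (@RGenOInfty.G R)
    (fun E => \int[mu]_(t in E) (v t)%:E = 0)%E) mE' => //.
  - exact: RGenOInfty.measurableE.
  - move=> _ _ [a ->] [b ->]; exists (Num.max a b).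
    by apply/seteqP; split=> t /=; rewrite !in_itv/= !andbT gt_max => /andP.
  - by move=> _ [a ->]; exact: ray0.
  - move=> S mS S0; have mSC := measurableC mS.
    have := v0; rewrite -(setUv S) integral_setU_EFin//.
    + by rewrite S0 add0e.
    + by rewrite setUv; case/integrableP: iv => /measurable_EFinP.
    + by apply/disj_setPS => t [].
  - move=> F mF tF F0; rewrite integral_bigcup//.
    + by rewrite eseries0.
    + by apply: iE; exact: bigcup_measurable.
have := @integral_ae_eq _ _ _ mu setT measurableT (cst 0%E) (fun t => (v t)%:E) iv.
move=> /(_ (measurable_cst _)) H.
have {}H := H (fun E _ mE => etrans (all0 E mE) (esym (integral0 _ _))).
by apply: filterS H => t /= /(_ I) [].
Qed.

(** Dominated convergence: on (0, 2 pi) the functions step_poly n (arc_poly a t)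
    tend to the indicator of t > a, except at t = a. *)
Lemma ray_integral_eq0 (v : R -> R) (a : R) : integrable v -> 0 <= a <= 2 * pi ->
  (forall n, \int[mu]_t (v t * step_poly n (arc_poly a t)) = 0) ->
  (\int[mu]_(t in `]a, +oo[) (v t)%:E = 0)%E.
Proof.
move=> iv a02 H.
have mv : measurable_fun [set: R] v by case/integrableP: iv => /measurable_EFinP.
have mray : measurable (`]a, +oo[%classic : set R) by exact: measurable_itv.
have marc : measurable_fun [set: R] (arc_poly a).
  apply: measurable_funD => //; apply: measurable_funM => //.
  apply: measurable_funB => //; apply: measurableT_comp => //.
    by apply: continuous_measurable_fun => t; exact: continuous_cos.
  exact: measurable_funB.
have mstep n : measurable_fun [set: R] (fun t => step_poly n (arc_poly a t)).
  by apply: measurable_funX; apply: measurable_funB => //; exact: measurable_funX.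
have bstep n t : `|v t * step_poly n (arc_poly a t)| <= `|v t|.
  have /andP[s0 s1] := step_poly_itv n (arc_poly_itv a t).
  by rewrite normrM (ger0_norm s0) ler_piMr.
have [|||||_ _ lim_] := @dominated_convergence _ _ _ mu setT measurableT
  (fun n t => (v t * step_poly n (arc_poly a t))%:E)
  (fun t => (v t * \1_(`]a, +oo[%classic : set R) t)%:E)
  (fun t => `|v t|%:E).
- by move=> n; apply/measurable_EFinP; apply: measurable_funM => //; exact: mstep.
- by apply/measurable_EFinP; apply: measurable_funM => //; exact: measurable_indic.
- apply: filterS2 ae_itv (ae_neq a) => t /andP[t0 t1] ta _.
  apply: cvg_EFin; first exact: nearW.
  apply: cvgM; first exact: cvg_cst.
  rewrite indicE; have [alt|tle] := ltP a t.
    rewrite mem_set/=; last by rewrite in_itv/= alt.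
    apply: step_poly_cvg1; have /andP[-> _] /= := arc_poly_itv a t.
    by apply: arc_poly_lt => //; rewrite alt.
  rewrite memNset/=; last by rewrite in_itv/= andbT; apply/negP; rewrite -leNgt.
  apply: step_poly_cvg0; have /andP[_ ->] := arc_poly_itv a t.
  by rewrite andbT; apply: arc_poly_gt => //; rewrite t0 lt_neqAle ta.
- exact: integrable_norm.
- by apply: aeW => t n _; rewrite /= lee_fin.
rewrite integral_mkcond.
have h0 : (fun n => \int[mu]_t (v t * step_poly n (arc_poly a t))%:E)%E =
    (fun=> 0%E).
  apply/funext => n; rewrite -[LHS]fineK.
    by congr EFin; exact: H.
  apply: integrable_fin_num => //; apply: ae_le_integrable (integrable_norm iv).
    by apply: measurable_funM => //; exact: mstep.
  by apply: aeW => t; exact: bstep.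
transitivity (\int[mu]_t (v t * \1_(`]a, +oo[%classic : set R) t)%:E)%E.
  apply: eq_integral => t _; rewrite patchE indicE.
  by case: ifPn => _; rewrite ?mulr1 ?mulr0.
move: lim_; rewrite /= h0 => lim_; apply: esym.
by apply: (cvg_unique _ _ lim_) => //; exact: cvg_cst.
Qed.

Definition fourier_null w : Prop :=
  cintegrable w /\ forall n : int, cintegral (fun t => w t * zeta t ^ n) = 0.

(** These multipliers form an algebra that contains zeta and its inverse, so the
    polynomial step_poly n of the trigonometric polynomial arc_poly a belongs to
    it without any expansion into characters. *)
Definition fourier_mult (p : R -> R[i]) : Prop :=
  forall w, fourier_null w -> fourier_null (fun t => w t * p t).

Lemma fourier_multM p q : fourier_mult p -> fourier_mult q ->
  fourier_mult (fun t => p t * q t).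
Proof. by move=> hp hq w /hp /hq; under eq_fun do rewrite -mulrA. Qed.

Lemma cintegrable_mul_zetaX w n : cintegrable w ->
  cintegrable (fun t => w t * zeta t ^ n).
Proof.
move=> iw; under eq_fun do rewrite mulrC.
apply: cintegrable_mul_bounded => //; first exact: cmeasurable_zetaX.
by apply: ae_bounded_unimodular; apply: aeW => t; exact: sqmod_zetaX.
Qed.

Lemma fourier_multD p q : fourier_mult p -> fourier_mult q ->
  fourier_mult (fun t => p t + q t).
Proof.
move=> hp hq w hw; have [ip np] := hp w hw; have [iq nq] := hq w hw.
split; first by under eq_fun do rewrite mulrDr; exact: cintegrableD.
move=> n; under eq_fun do rewrite mulrDr mulrDl.
by rewrite cintegralD ?np ?nq ?addr0//; exact: cintegrable_mul_zetaX.
Qed.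

Lemma fourier_mult_cst (c : R[i]) : fourier_mult (fun=> c).
Proof.
move=> w [iw nw]; split; first by under eq_fun do rewrite mulrC; exact: cintegrableZ.
move=> n; under eq_fun do rewrite mulrAC mulrC.
by rewrite cintegralZ ?nw ?mulr0//; exact: cintegrable_mul_zetaX.
Qed.

Lemma fourier_mult_zetaX m : fourier_mult (fun t => zeta t ^ m).
Proof.
move=> w [iw nw]; split; first exact: cintegrable_mul_zetaX.
by move=> n; under eq_fun do rewrite -mulrA -zetaXD.
Qed.

Lemma fourier_multX p n : fourier_mult p -> fourier_mult (fun t => p t ^+ n).
Proof.
move=> hp; elim: n => [|n ih].
  by under eq_fun do rewrite expr0; exact: fourier_mult_cst.
by under eq_fun do rewrite exprS; exact: fourier_multM.
Qed.

Lemma fourier_mult_arc_poly a : fourier_mult (fun t => (arc_poly a t)%:C).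
Proof.
pose z := zeta (a / 2).
have -> : (fun t => (arc_poly a t)%:C) = fun t => (2^-1 - cos (a / 2) / 4)%:C +
    (z^* / 8%:R * zeta t ^ 1 + z / 8%:R * zeta t ^ (-1)).
  apply/funext => t; rewrite /arc_poly cosB expr1z exprN1 zetaV.
  rewrite (_ : 8%:R^-1 = (8^-1)%:C); last by rewrite fmorphV rmorph_nat.
  apply: complex_eqP; rewrite !parts /=; by field.
apply: fourier_multD; first exact: fourier_mult_cst.
by apply: fourier_multD; apply: fourier_multM;
  [exact: fourier_mult_cst|exact: fourier_mult_zetaX|
   exact: fourier_mult_cst|exact: fourier_mult_zetaX].
Qed.

Lemma fourier_mult_step n a :
  fourier_mult (fun t => (step_poly n (arc_poly a t))%:C).
Proof.
have -> : (fun t => (step_poly n (arc_poly a t))%:C) =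
    fun t => (1 + (-1) * (arc_poly a t)%:C ^+ n) ^+ (2 ^ n).
  by apply/funext => t; rewrite mulN1r /step_poly rmorphXn rmorphB rmorphXn rmorph1.
apply: fourier_multX; apply: fourier_multD; first exact: fourier_mult_cst.
apply: fourier_multM; first exact: fourier_mult_cst.
exact/fourier_multX/fourier_mult_arc_poly.
Qed.

(** The real and imaginary parts of w integrate to 0 over every ray, because the
    indicator of a ray is a bounded limit of multipliers. *)
Lemma fourier_null_ae_eq0 w : fourier_null w -> ae_equal w (cst 0).
Proof.
move=> hw; have [[i1 i2] nw] := hw.
have H a n : cintegral (fun t => w t * (step_poly n (arc_poly a t))%:C) = 0.
  have [_ /(_ 0)] := fourier_mult_step n a hw.
  by under eq_fun do rewrite expr0z mulr1.
have H0 : cintegral w = 0.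
  by have := nw 0; under eq_fun do rewrite expr0z mulr1.
have null (v : R -> R) : integrable v -> \int[mu]_t v t = 0 ->
    (forall a n, \int[mu]_t (v t * step_poly n (arc_poly a t)) = 0) ->
    {ae mu, forall t, v t = 0}.
  move=> iv v0 vstep.
  have v0' : (\int[mu]_t (v t)%:E = 0)%E.
    by rewrite -[LHS]fineK; [congr EFin; exact: v0|exact: integrable_fin_num].
  apply: ae_eq0_of_rays => // a.
  have ray b : 0 <= b <= 2 * pi -> (\int[mu]_(t in `]b, +oo[) (v t)%:E = 0)%E.
    by move=> hb; apply: ray_integral_eq0.
  have mray (b : R) : measurable (`]b, +oo[%classic : set R) by exact: measurable_itv.
  have mv : measurable_fun [set: R] (fun t => (v t)%:E) by case/integrableP: iv.
  (* rays that start outside [0, 2 pi] agree on (0, 2 pi) with rays that do not *)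
  have clamp b : 0 <= b <= 2 * pi ->
      (forall t, 0 < t < 2 * pi -> (a < t) = (b < t)) ->
      (\int[mu]_(t in `]a, +oo[) (v t)%:E = 0)%E.
    move=> hb ab; rewrite -(ray b hb) [LHS]integral_mkcond [RHS]integral_mkcond.
    apply: ae_eq_integral => //.
    - by apply/(measurable_restrictT _ (mray a)); exact: measurable_funTS.
    - by apply/(measurable_restrictT _ (mray b)); exact: measurable_funTS.
    apply: filterS ae_itv => t /ab abt _; rewrite !patchE.
    by rewrite !mem_setE !in_itv/= abt.
  have pi0 := pi_gt0 R.
  have [a0|a0] := ltP a 0.
    by apply: (clamp 0) => [|t]; [apply/andP; split|]; lra.
  have [a1|a1] := ltP (2 * pi) a.
    by apply: (clamp (2 * pi)) => [|t]; [apply/andP; split|]; lra.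
  by apply: ray; rewrite a0.
have h1 : {ae mu, forall t, complex.Re (w t) = 0}.
  apply: null => //; first by have /(congr1 (@complex.Re R)) := H0.
  move=> a n; have /(congr1 (@complex.Re R)) /= := H a n.
  by under eq_Rintegral do rewrite !parts /= mulr0 subr0.
have h2 : {ae mu, forall t, complex.Im (w t) = 0}.
  apply: null => //; first by have /(congr1 (@complex.Im R)) := H0.
  move=> a n; have /(congr1 (@complex.Im R)) /= := H a n.
  by under eq_Rintegral do rewrite !parts /= mulr0 add0r.
by apply: filterS2 h1 h2 => t ? ?; exact: complex_eqP.
Qed.
(** * Orthogonality of the characters *)

(** The integrand is shifted to 1 + cos, which is nonnegative and has the
    primitive F; the phase phi makes the lemma cover the sine as well. *)
Lemma integral_cos_harmonic (n : nat) (phi : R) :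
  \int[mu]_t cos (n.+1%:R * t + phi) = 0.
Proof.
pose r : R := n.+1%:R; have r0 : r != 0 by rewrite pnatr_eq0.
pose f (t : R) : R := 1 + cos (r * t + phi).
pose F (t : R) : R := t + r^-1 * sin (r * t + phi).
have cf : continuous f.
  move=> t; apply: cvgD; first exact: cvg_cst.
  apply: (@continuous_comp _ _ _ (fun t => r * t + phi) cos); last exact: continuous_cos.
  by apply: cvgD; [apply: cvgM; [exact: cvg_cst|exact: cvg_id]|exact: cvg_cst].
have mf : measurable_fun [set: R] f by exact: continuous_measurable_fun.
have f0 t : 0 <= f t by rewrite /f; have := cos_geN1 (r * t + phi); lra.
have dF t : is_derive t (1 : R) F (f t).
  rewrite /F /f; apply: is_derive_eq.
  rewrite /GRing.scale /=; by field.
have cF : continuous F.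
  by move=> t; apply: differentiable_continuous; apply/derivable1_diffP; exact: ex_derive.
have pi2 := circle_length_gt0 (R := R).
have If : (\int[mu]_t (f t)%:E = 1)%E.
  rewrite integral_uniform//; last first.
    exact/measurable_EFinP.
  rewrite subr0 (@continuous_FTC2 _ f F)//.
  - rewrite /F mulr0 !add0r.
    have -> : r * (2 * pi) + phi = phi + (pi *+ 2) *+ n.+1.
      rewrite -[(pi *+ 2) *+ n.+1]mulr_natl -/r mulr2n; ring.
    rewrite (periodicn (@sinD2pi R)) -EFinD -EFinM; congr EFin.
    by rewrite addrK mulVf// gt_eqF.
  - exact: continuous_subspaceT.
  - split.
    + by move=> t _; exact: ex_derive.
    + by apply: cvg_at_right_filter; exact: cF.
    + by apply: cvg_at_left_filter; exact: cF.
  - by move=> t _; rewrite derive1E; exact: derive_val.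
have icos : integrable (fun t => cos (r * t + phi)).
  apply: (@ae_le_integrable _ (fun=> 1)).
  - apply: (measurableT_comp (f := cos)).
      by apply: continuous_measurable_fun; exact: continuous_cos.
    by apply: measurable_funD => //; exact: measurable_funM.
  - by apply: aeW => t; exact: cos_max.
  - exact: finite_measure_integrable_cst.
have : \int[mu]_t f t = 1 by rewrite /Rintegral If.
rewrite RintegralD//; last exact: finite_measure_integrable_cst.
by rewrite arc_Rintegral_cst => /(canRL (addKr _)) ->; rewrite addNr.
Qed.

Lemma zetaXn (n : nat) (t : R) :
  zeta t ^ n%:Z = cos (n%:R * t) +i* sin (n%:R * t).
Proof.
elim: n => [|n ih]; first by rewrite expr0z !mul0r cos0 sin0.
rewrite exprSz ih -natr1 mulrDl mul1r.
by apply: complex_eqP; rewrite !parts /= ?cosD ?sinD; ring.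
Qed.

Lemma cintegral_zetaX (n : int) : n != 0 -> cintegral (fun t => @zeta R t ^ n) = 0.
Proof.
have pos (k : nat) : cintegral (fun t => @zeta R t ^ Posz k.+1) = 0.
  under eq_fun do rewrite zetaXn.
  apply: complex_eqP => /=.
    by have := integral_cos_harmonic k 0; under eq_Rintegral do rewrite addr0.
  have := integral_cos_harmonic k (- (pi / 2)).
  by under eq_Rintegral do rewrite cosBpihalf.
case: n => [[//|k]|k] _; first exact: pos.
rewrite NegzE; under eq_fun do rewrite -zetaXJ.
rewrite cintegralJ ?pos ?conjC0//.
have := cintegrable_mulJ (L2_zetaX k.+1) (L2_cst 1).
by under eq_fun do rewrite conjC1 mulr1.
Qed.

Lemma ip_zetaX (f : R -> R[i]) (n : int) :
  inner_product f (fun t => zeta t ^ n) = cintegral (fun t => f t * zeta t ^ (- n)).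
Proof. by congr cintegral; apply/funext => t; rewrite zetaXJ. Qed.

Lemma ip_zetaX_zetaX (m n : int) : m != n ->
  inner_product (fun t => @zeta R t ^ m) (fun t => zeta t ^ n) = 0.
Proof.
move=> mn; rewrite ip_zetaX; under eq_fun do rewrite -zetaXD.
by apply: cintegral_zetaX; rewrite subr_eq0.
Qed.

Lemma L2_fourier_eq0 f : L2 f ->
  (forall n : int, inner_product f (fun t => zeta t ^ n) = 0) -> ae_equal f (cst 0).
Proof.
move=> hf H; apply: fourier_null_ae_eq0; split.
  have := cintegrable_mulJ hf (L2_cst 1).
  by under eq_fun do rewrite conjC1 mulr1.
by move=> n; have := H (- n); rewrite ip_zetaX opprK.
Qed.

(** * The Hardy space and kernels of Toeplitz operators *)

Definition characters (P : int -> Prop) : set (R -> R[i]) :=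
  [set fun t => zeta t ^ n | n in P].

Lemma characters_L2 P : characters P `<=` L2.
Proof. by move=> _ [n _ <-]; exact: L2_zetaX. Qed.

Lemma hardyE : @hardy R = ann (characters (fun n => n < 0)).
Proof.
apply/seteqP; split=> f [hf H]; split=> //.
  by move=> _ [n n0 <-]; exact: H.
by move=> n n0; apply: H; exists n.
Qed.

Lemma hardy_L2 : @hardy R `<=` L2.
Proof. by move=> f []. Qed.

Lemma hardy_zetaX (n : nat) : @hardy R (fun t => zeta t ^ n).
Proof.
split; first exact: L2_zetaX.
by move=> m m0; apply: ip_zetaX_zetaX; rewrite eq_sym lt_eqF// (lt_le_trans m0).
Qed.

(** This is the density of the analytic polynomials in the Hardy space.  Let g be
    the projection of h onto the closed span of the zeta^n with n >= 0.  Then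
    h - g is orthogonal to these, and to the zeta^n with n < 0 because h and g
    both are; so h = g, and f is orthogonal to g. *)
Lemma ip_hardy_eq0 f : L2 f ->
  (forall n : nat, inner_product f (fun t => zeta t ^ n) = 0) ->
  forall h, hardy h -> inner_product f h = 0.
Proof.
move=> hf H h hh.
pose P := characters (fun n => 0 <= n).
have PL : P `<=` L2 by exact: characters_L2.
have APL : ann P `<=` L2 by move=> k [].
have fP : ann P f by split=> // _ [[n|//] _ <-]; exact: H.
have Lh := hardy_L2 hh.
have [g [Lg gP] hgP] := orthogonal_decomposition APL Lh.
move: hgP; rewrite ann_ann_ann// => -[Lhg hgP].
have hg0 : ae_equal (fun t => h t - g t) (cst 0).
  apply: L2_fourier_eq0 => // n; have [n0|n0] := leP 0 n.
    by apply: hgP; exists n.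
  rewrite ip_subl//; last exact: L2_zetaX.
  have -> : inner_product h (fun t => zeta t ^ n) = 0 by exact: hh.2.
  rewrite gP ?subr0//; split; first exact: L2_zetaX.
  by move=> _ [m m0 <-]; apply: ip_zetaX_zetaX; rewrite lt_eqF// (lt_le_trans n0).
rewrite ip_conj// (@ae_eq_ip _ g)//; last first.
  by apply: filterS hg0 => t /eqP; rewrite subr_eq0 => /eqP.
by rewrite gP// conjC0.
Qed.

Lemma Linfty_bounded G : Linfty G -> cmeasurable G /\ ae_bounded G.
Proof.
have B (u : R -> R) : u \in Lfun mu +oo%E ->
    measurable_fun [set: R] u /\ exists M : R, {ae mu, forall t, `|u t| <= M}.
  rewrite inE => /andP[]; rewrite !inE /= => mu_; rewrite /finite_norm unlock /Lnorm.
  have -> : (0 < mu [set: R])%E by rewrite arc_length_setT.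
  by move=> /(@ess_supr_bounded _ _ _ mu (fun t => `|u t|)).
move=> [/B[m1 [M1 b1]] /B[m2 [M2 b2]]]; split=> //.
exists (M1 ^+ 2 + M2 ^+ 2); apply: filterS2 b1 b2 => t h1 h2.
rewrite /sqmod -(real_normK (num_real (complex.Re _))).
rewrite -(real_normK (num_real (complex.Im _))).
by rewrite lerD// ler_pXn2r ?nnegrE// (le_trans _ h1, le_trans _ h2).
Qed.

Lemma unimodular_Linfty G : cmeasurable G -> {ae mu, forall t, sqmod (G t) = 1} ->
  Linfty G.
Proof.
move=> [m1 m2] h.
have B (u : R -> R) : measurable_fun [set: R] u ->
    {ae mu, forall t, u t ^+ 2 <= 1} -> u \in Lfun mu +oo%E.
  move=> mu_ b; rewrite inE; apply/andP; split; rewrite inE//= /finite_norm.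
  rewrite unlock /Lnorm; have -> : (0 < mu [set: R])%E by rewrite arc_length_setT.
  apply: (@le_lt_trans _ _ 1%E); last exact: ltry.
  apply/ess_supP; apply: filterS b => t b /=; rewrite lee_fin.
  by rewrite -(@ler_pXn2r _ 2)// ?nnegrE// real_normK ?num_real// expr1n.
split; apply: B => //; apply: filterS h => t <-; rewrite /sqmod.
  by rewrite lerDl sqr_ge0.
by rewrite lerDr sqr_ge0.
Qed.

(** The orthogonal projection exists, so the choice made in [orth_proj] is that
    projection, and T_G f = 0 says that G f is orthogonal to the zeta^n with
    n >= 0.  Moving G to the other side of the inner product shows that the
    kernel is the trace on the Hardy space of a closed subspace. *)
Lemma ker_toeplitzP G : Linfty G -> ker_toeplitz G =
  hardy `&` ann [set fun t => (G t)^* * zeta t ^ n | n in [set: nat]].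
Proof.
move=> /Linfty_bounded[mG bG].
have step f : hardy f -> ker_toeplitz G f <->
    forall n : nat, inner_product (fun t => G t * f t) (fun t => zeta t ^ n) = 0.
  move=> hf; have Lf := hardy_L2 hf.
  have LF : L2 (fun t => G t * f t) by exact: L2_mul_bounded.
  have [hP oP] : hardy (toeplitz G f) /\
      forall h, hardy h -> inner_product (fun t => G t * f t - toeplitz G f t) h = 0.
    have [g hg [_ og]] :=
      orthogonal_decomposition (@characters_L2 (fun n => n < 0)) LF.
    apply: (@xgetPex _ (cst 0) [set g | hardy g /\ forall h, hardy h ->
      inner_product (fun t => G t * f t - g t) h = 0]).
    by exists g; rewrite hardyE.
  have LP := hardy_L2 hP.
  split=> [[_ P0] n|H].
    rewrite -(oP _ (hardy_zetaX n)); apply: ae_eq_ip => //.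
    - exact: L2B.
    - exact: L2_zetaX.
    - by apply: filterS P0 => t /= ->; rewrite subr0.
  split=> //; apply: sqnorm_eq0 => //; apply: (@complexI R); rewrite -ip_self.
  have := oP _ hP; rewrite ip_subl// (ip_hardy_eq0 LF H hP) sub0r.
  by move/eqP; rewrite oppr_eq0 => /eqP.
apply/seteqP; split=> f.
  move=> kf; have hf := kf.1; split=> //; split; first exact: hardy_L2.
  by move=> _ [n _ <-]; rewrite -ip_mull; exact: (step f hf).1.
move=> [hf [_ H]]; apply/step => // n; rewrite ip_mull; apply: H.
by exists n.
Qed.

(** * Closed subspaces invariant under the shift *)

Lemma ip_zetaX_mull (n : int) f h :
  inner_product (fun t => zeta t ^ n * f t) h =
  inner_product f (fun t => zeta t ^ (- n) * h t).
Proof. by rewrite ip_mull; under [in LHS]eq_fun do rewrite zetaXJ. Qed.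

Lemma zetaX_mulA (m n : int) f :
  (fun t : R => zeta t ^ m * (zeta t ^ n * f t)) = (fun t => zeta t ^ (m + n) * f t).
Proof. by apply/funext => t; rewrite mulrA -zetaXD. Qed.

Lemma zeta0_mul f : (fun t : R => zeta t ^ 0 * f t) = f.
Proof. by apply/funext => t; rewrite expr0z mul1r. Qed.

(** Multiplication by zeta^n is unitary, so it maps closed subspaces to closed
    subspaces. *)
Lemma ann_zetaX (n : int) A f : A `<=` L2 ->
  ann [set fun t => zeta t ^ n * g t | g in A] f <->
  ann A (fun t => zeta t ^ (- n) * f t).
Proof.
move=> AL; split=> -[Lf H].
  split; first exact: L2_zetaX_mul.
  by move=> g Ag; rewrite ip_zetaX_mull opprK; apply: H; exists g.
split.
  by have := L2_zetaX_mul n Lf; rewrite zetaX_mulA subrr zeta0_mul.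
by move=> _ [g Ag <-]; have := H g Ag; rewrite ip_zetaX_mull opprK.
Qed.

Section ShiftInvariant.
Variable A : set (R -> R[i]).
Hypothesis AL : A `<=` L2.
Hypothesis Ashift : forall s, A s -> A (fun t => zeta t ^ 1 * s t).

Let N := ann (ann A).
Let annAL : ann A `<=` L2. Proof. by move=> f []. Qed.

Lemma closed_span_shift (n : nat) f : N f -> N (fun t => zeta t ^ n * f t).
Proof.
have back g : ann A g -> ann A (fun t => zeta t ^ (- 1) * g t).
  move=> [Lg H]; split; first exact: L2_zetaX_mul.
  by move=> s /Ashift As; rewrite ip_zetaX_mull opprK; exact: H.
have step g : N g -> N (fun t => zeta t ^ 1 * g t).
  move=> [Lg H]; split; first exact: L2_zetaX_mul.
  by move=> s /back As; rewrite ip_zetaX_mull; exact: H.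
elim: n => [|n ih] Nf; first by rewrite zeta0_mul.
have := step _ (ih Nf); by rewrite zetaX_mulA -PoszD.
Qed.

(** All zeta^n r with n >= 1 are in zN, hence orthogonal to r: the nonzero Fourier
    coefficients of |r|^2 vanish, and |r|^2 is constant by uniqueness. *)
Lemma wandering_unimodular r : N r ->
  (forall g, N g -> inner_product r (fun t => zeta t ^ 1 * g t) = 0) ->
  ~ ae_equal r (cst 0) ->
  exists psi, [/\ N psi, (forall g, N g ->
      inner_product psi (fun t => zeta t ^ 1 * g t) = 0) &
    {ae mu, forall t, sqmod (psi t) = 1}].
Proof.
move=> Nr or r0; have Lr : L2 r by case: Nr.
pose c := sqnorm r.
have c0 : 0 < c.
  by rewrite lt_neqAle sqnorm_ge0 andbT eq_sym; apply/eqP => /(sqnorm_eq0 Lr).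
have irr := cintegrable_mulJ Lr Lr.
have icc : cintegrable (fun _ : R => - c%:C).
  have := cintegrable_mulJ (L2_cst (- c%:C)) (L2_cst 1).
  by under eq_fun do rewrite conjC1 mulr1.
have rn (n : nat) : inner_product r (fun t => zeta t ^ n.+1 * r t) = 0.
  have := or _ (closed_span_shift n Nr); by rewrite zetaX_mulA -PoszD.
have rz n : n != 0 -> inner_product r (fun t => zeta t ^ n * r t) = 0.
  case: n => [[//|n]|n] _; first exact: rn.
  rewrite NegzE -ip_zetaX_mull ip_conj ?rn ?conjC0//; exact: L2_zetaX_mul.
have null : fourier_null (fun t => r t * (r t)^* + - c%:C).
  split; first exact: cintegrableD.
  move=> n; under eq_fun do rewrite mulrDl.
  rewrite cintegralD; [|exact: cintegrable_mul_zetaX|exact: cintegrable_mul_zetaX].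
  have -> : cintegral (fun t => r t * (r t)^* * zeta t ^ n) =
      inner_product r (fun t => zeta t ^ (- n) * r t).
    congr cintegral; apply/funext => t; rewrite rmorphM /= zetaXJ opprK; ring.
  rewrite cintegralZ; last first.
    by have := cintegrable_mulJ (L2_zetaX n) (L2_cst 1);
      under eq_fun do rewrite conjC1 mulr1.
  have [->|n0] := eqVneq n 0.
    rewrite zeta0_mul ip_self; under eq_fun do rewrite expr0z.
    have -> : cintegral (fun=> 1 : R[i]) = 1.
      by apply: complex_eqP => /=; rewrite arc_Rintegral_cst.
    by rewrite mulr1 subrr.
  by rewrite rz ?oppr_eq0// cintegral_zetaX// mulr0 addr0.
pose k : R := (Num.sqrt c)^-1.
have kk : k ^+ 2 = c^-1 by rewrite exprVn sqr_sqrtr// ltW.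
exists (fun t => k%:C * r t); split.
- exact: annZ.
- by move=> g Ng; rewrite ip_scalel ?or ?mulr0//; apply: L2_zetaX_mul; case: Ng.
- apply: filterS (fourier_null_ae_eq0 null) => t /eqP.
  rewrite subr_eq0 mulrJ => /eqP[h]; rewrite sqmodM h /sqmod /= expr0n addr0 kk.
  by rewrite mulVf// gt_eqF.
Qed.

(** Beurling's theorem, in the form N = psi H^2 seen from the annihilator of N.
    If zN is not all of N, the projection of some a in N off zN is a nonzero
    wandering vector, which yields a unimodular psi.  For g in N the function
    conj psi * g has vanishing negative Fourier coefficients, because psi is
    orthogonal to zeta^n g for n >= 1; so g is psi times a Hardy function, and
    whatever is orthogonal to all psi zeta^n is orthogonal to g. *)
Lemma beurling : (exists2 a, N a & ~ N (fun t => zeta t ^ (- 1) * a t)) ->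
  exists psi, [/\ N psi, {ae mu, forall t, sqmod (psi t) = 1} &
    ann A = ann [set fun t => psi t * zeta t ^ n | n in [set: nat]]].
Proof.
move=> [a Na aN].
pose B := [set fun t : R => zeta t ^ 1 * g t | g in ann A].
have BL : B `<=` L2 by move=> _ [g /annAL Lg <-]; exact: L2_zetaX_mul.
have La : L2 a by case: Na.
have annBE f : ann B f <-> N (fun t => zeta t ^ (- 1) * f t) by exact: ann_zetaX.
have [b Bb rB] := orthogonal_decomposition BL La.
have Lb : L2 b by case: Bb.
have Nb : N b.
  have := closed_span_shift 1 ((annBE b).1 Bb); by rewrite zetaX_mulA subrr zeta0_mul.
have [||psi [Npsi opsi psi1]] :=
    @wandering_unimodular (fun t => a t - b t) (annB annAL Na Nb).
- move=> g Ng; apply: rB.2; apply/annBE.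
  by rewrite zetaX_mulA addNr zeta0_mul.
- move=> ab; apply: aN; apply/annBE; apply: ae_eq_ann Bb => //.
  by apply: filterS ab => t /eqP; rewrite subr_eq0 => /eqP.
exists psi; split=> //.
have Lpsi : L2 psi by case: Npsi.
have mpsi := L2_cmeasurable Lpsi; have bpsi := ae_bounded_unimodular psi1.
have Lpsibar f : L2 f -> L2 (fun t => (psi t)^* * f t).
  by apply: L2_mul_bounded; [exact: cmeasurableJ|exact: ae_boundedJ].
apply/seteqP; split=> f [Lf H]; split=> //.
  move=> _ [n _ <-]; under [X in inner_product _ X]eq_fun do rewrite mulrC.
  have [Ln on] := closed_span_shift n Npsi.
  by rewrite ip_conj// on ?conjC0.
move=> g Ag; have Lg := AL Ag.
have Ng : N g by exact: sub_ann_ann.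
have psig : hardy (fun t => (psi t)^* * g t).
  split=> [|n n0]; first exact: Lpsibar.
  rewrite /fourier_coef ip_mull; under [X in inner_product _ X]eq_fun do
    rewrite conjCK mulrC.
  have := ip_zetaX_mull (- n) g psi; rewrite opprK => <-.
  rewrite ip_conj//; last exact: L2_zetaX_mul.
  case: n n0 => [//|n] _; rewrite NegzE opprK.
  have := opsi _ (closed_span_shift n Ng); rewrite zetaX_mulA -PoszD => ->.
  by rewrite conjC0.
have : inner_product (fun t => (psi t)^* * f t) (fun t => (psi t)^* * g t) = 0.
  apply: ip_hardy_eq0 psig; first exact: Lpsibar.
  move=> n; rewrite ip_mull; under [X in inner_product _ X]eq_fun do rewrite conjCK.
  by apply: H; exists n.
rewrite -ip_mulr.
move=> <-; rewrite [LHS]ip_conj// [RHS]ip_conj//; last first.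
- exact: L2_mul_bounded (Lpsibar _ Lg).
congr (_ ^*); apply: ae_eq_ip => //.
- exact: L2_mul_bounded (Lpsibar _ Lg).
- by apply: filterS psi1 => t h; rewrite mulrA mulrJ h mul1r.
Qed.

End ShiftInvariant.

(** * Kernels that contain the constants *)

Lemma model_spaceE beta : cmeasurable beta -> ae_bounded beta ->
  model_space beta =
  hardy `&` ann [set fun t => beta t * zeta t ^ n | n in [set: nat]].
Proof.
move=> mb bb; apply/seteqP; split=> f [hf H]; split=> //.
  split=> [|_ [n _ <-]]; first exact: hardy_L2.
  exact/H/hardy_zetaX.
move=> h hh; rewrite ip_mulr; apply: ip_hardy_eq0 hh.
  by apply: L2_mul_bounded (hardy_L2 hf); [exact: cmeasurableJ|exact: ae_boundedJ].
by move=> n; rewrite -ip_mulr; apply: H.2; exists n.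
Qed.

(** T_G 1 = 0 says that conj G has Fourier coefficients only at indices n >= 1,
    so the closed span N of the conj G * zeta^n is an invariant subspace of zH^2.
    Dividing by zeta indefinitely inside N would kill all Fourier coefficients
    of G; hence Beurling's theorem applies, and its psi is zeta times an inner
    function. *)
Lemma ker_toeplitz_one_model G : Linfty G -> ~ ae_equal G (cst 0) ->
  ker_toeplitz G (cst 1) ->
  exists alpha, inner_function alpha /\
    ker_toeplitz G = model_space (fun t => zeta t * alpha t).
Proof.
move=> LG G0; rewrite (ker_toeplitzP LG).
have [mG bG] := Linfty_bounded LG.
set S := [set _ | _ in _] => -[_ [_ oneS]].
have LGJ : L2 (fun t => (G t)^*).
  by apply: L2_bounded; [exact: cmeasurableJ|exact: ae_boundedJ].
have SE n : (fun t => (G t)^* * zeta t ^ n) = (fun t => zeta t ^ n * (G t)^*).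
  by apply/funext => t; rewrite mulrC.
have SL : S `<=` L2 by move=> _ [n _ <-]; rewrite SE; exact: L2_zetaX_mul.
have Sshift s : S s -> S (fun t => zeta t ^ 1 * s t).
  move=> [n _ <-]; exists n.+1 => //.
  by apply/funext => t; rewrite exprSz expr1z; ring.
have one (k : int) : 0 <= k ->
    inner_product (cst 1) (fun t => zeta t ^ k * (G t)^*) = 0.
  by case: k => [k|//] _; rewrite -SE; apply: oneS; exists k.
pose P := characters (fun n => n <= 0).
have SP : S `<=` ann P.
  move=> _ [n _ <-]; split; first by rewrite SE; exact: L2_zetaX_mul.
  move=> _ [m m0 <-]; rewrite SE ip_conj//; last 2 first.
  - exact: L2_zetaX.
  - exact: L2_zetaX_mul.
  rewrite [X in X^*](_ : _ =
      inner_product (cst 1) (fun t => zeta t ^ (Posz n - m) * (G t)^*)).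
    by rewrite one ?conjC0// subr_ge0 (le_trans m0).
  congr cintegral; apply/funext => t; rewrite !rmorphM /= !zetaXJ opprB zetaXD; ring.
have NP : ann (ann S) `<=` ann P.
  rewrite -(ann_ann_ann (@characters_L2 _)); exact/ann_anti/ann_anti.
have [|psi [Npsi psi1 annE]] := beurling SL Sshift.
  apply: contrapT => H.
  have back n : ann (ann S) (fun t => zeta t ^ (- Posz n) * (G t)^*).
    elim: n => [|n ih].
      by apply: sub_ann_ann => //; exists 0%N => //; rewrite SE oppr0.
    apply: contrapT => h; apply: H.
    exists (fun t => zeta t ^ (- Posz n) * (G t)^*) => //.
    by rewrite zetaX_mulA -opprD -PoszD.
  apply: G0.
  have : ae_equal (fun t => (G t)^*) (cst 0).
    apply: L2_fourier_eq0 => // -[n|n].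
      have := (NP _ (back n)).2 (fun t => zeta t ^ 0) (ex_intro2 _ _ 0 (lexx 0) erefl).
      rewrite ip_zetaX_mull opprK.
      by under [X in inner_product _ X]eq_fun do rewrite expr0z mulr1.
    have := (NP _ (back 0%N)).2 (fun t => zeta t ^ (Negz n)).
    by rewrite oppr0 zeta0_mul; apply; exists (Negz n).
  by apply: filterS => t /eqP; rewrite conjC_eq0 => /eqP.
have Lpsi : L2 psi by case: Npsi.
pose alpha t := zeta t ^ (- 1) * psi t.
have alpha1 : {ae mu, forall t, sqmod (alpha t) = 1}.
  by apply: filterS psi1 => t h; rewrite sqmodM sqmod_zetaX h mul1r.
have Lalpha : L2 alpha by exact: L2_zetaX_mul.
exists alpha; split.
  split; last by apply: filterS alpha1 => t /norm1_sqmod.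
    split=> // n n0; rewrite /fourier_coef ip_zetaX_mull opprK.
    under [X in inner_product _ X]eq_fun do rewrite -zetaXD.
    by apply: (NP _ Npsi).2; exists (1 + n) => //; move: n0; lia.
  by apply: unimodular_Linfty => //; exact: L2_cmeasurable.
have -> : (fun t => zeta t * alpha t) = psi.
  by apply/funext => t; rewrite /alpha exprN1 mulrA divff ?mul1r// zeta_neq0.
rewrite model_spaceE ?annE//; first exact: L2_cmeasurable.
exact: ae_bounded_unimodular.
Qed.

(** The inner product of 1 with zeta^(n+1) alpha is conjugate to the Fourier
    coefficient of alpha at - (n + 1). *)
Lemma model_space_one (alpha : R -> R[i]) : inner_function alpha ->
  model_space (fun t => zeta t * alpha t) (cst 1).
Proof.
move=> [[Lalpha Ha] _ alpha1].
have alpha1' : {ae mu, forall t, sqmod (alpha t) = 1}.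
  by apply: filterS alpha1 => t /norm1_sqmod.
have b : ae_bounded (fun t => zeta t * alpha t).
  by apply: ae_bounded_unimodular; apply: filterS alpha1' => t h;
    rewrite sqmodM sqmod_zeta h mul1r.
rewrite model_spaceE//; last first.
  exact/(cmeasurableM cmeasurable_zeta)/L2_cmeasurable.
have hone : hardy (cst 1 : R -> R[i]).
  by have := hardy_zetaX 0; under eq_fun do rewrite expr0z.
split=> //; split; first exact: L2_cst.
move=> _ [n _ <-]; have := Ha (- Posz n.+1) isT; rewrite /fourier_coef => h.
have -> : (fun t => zeta t * alpha t * zeta t ^ n) =
    (fun t => zeta t ^ (Posz n.+1) * alpha t).
  by apply/funext => t; rewrite exprSz; ring.
rewrite ip_conj//; last 2 first.
- exact: L2_zetaX_mul.
- exact: L2_cst.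
rewrite ip_zetaX_mull; under [X in inner_product _ X]eq_fun do rewrite mulr1.
by rewrite h conjC0.
Qed.

End CircleIntegral.

Theorem corollary2p3 (R : realType) (G : R -> R[i])
    (hG : Linfty G) (hG0 : ~ ae_equal G (cst 0)) :
  ker_toeplitz G (cst 1) <->
  exists alpha : R -> R[i],
    inner_function alpha /\
    ker_toeplitz G = model_space (fun t => zeta t * alpha t).
Proof.
split=> [|[alpha [ialpha ->]]]; first exact: ker_toeplitz_one_model.
exact: model_space_one.
Qed.
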